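(* Let $F_{\alpha,\beta}=\{f^n_{\alpha(n),\beta(n)}\}_{n\in\mathbb{N}}$ be a Fučík system. For every natural $n\ge 2$ set $$ C_n(x,y)= \begin{cases} \dfrac{4(3+\pi^2)\pi}{9}\left(\dfrac{\max(\sqrt{x},\sqrt{y})}{n}-1\right)^2 & \text{for even } n,\\[2mm] 4\pi\,\dfrac{n^2(n^2+1)}{(n-1)^4}\left(\dfrac{\sqrt{x}}{n}-1\right)^2 & \text{for odd } n \text{ with } x\ge y,\\[2mm] 5\pi\,\dfrac{n^2(n^2+1)}{(n+1)^4}\left(\dfrac{\sqrt{y}}{n}-1\right)^2 & \text{for odd } n \text{ with } y>x. \end{cases} $$ If $$ \sum_{n=2}^{\infty} C_n(\alpha(n),\beta(n))<\frac{\pi}{2}, $$ then $F_{\alpha,\beta}$ is a Riesz basis in $L^2(0,\pi)$.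
   Context: Consider the boundary value problem $-u''(x)=\alpha u^+(x)-\beta u^-(x)$ in $(0,\pi)$, $u(0)=u(\pi)=0$, where $u^+=\max(u,0)$, $u^-=\max(-u,0)$, and $\alpha,\beta$ are real parameters. For $\alpha,\beta>0$ define the curves: for even $n\ge 2$, $$\Gamma_n=\Big\{(\alpha,\beta):\ \tfrac{n}{2}\tfrac{\pi}{\sqrt{\alpha}}+\tfrac{n}{2}\tfrac{\pi}{\sqrt{\beta}}=\pi\Big\},$$ and for odd $n\ge 3$, $$\Gamma_n=\Big\{(\alpha,\beta):\ \tfrac{n+1}{2}\tfrac{\pi}{\sqrt{\alpha}}+\tfrac{n-1}{2}\tfrac{\pi}{\sqrt{\beta}}=\pi\Big\}.$$ Normalized Fučík eigenfunction: for $n\ge2$ and $(\alpha,\beta)\in\Gamma_n$, $f^n_{\alpha,\beta}$ is the $C^2$-solution of the boundary value problem $-u''=\alpha u^+-\beta u^-$ in $(0,\pi)$, $u(0)=u(\pi)=0$, with $(f^n_{\alpha,\beta})'(0)>0$ and $\sup_{x\in[0,\pi]}|f^n_{\alpha,\beta}(x)|=1$. Explicitly, with $l_1=\pi/\sqrt{\alpha}$, $l_2=\pi/\sqrt{\beta}$, $l=l_1+l_2$, $k\in\{0,1,2,\dots\}$: if $\alpha\ge n^2\ge\beta$, then $f^n_{\alpha,\beta}(x)=\frac{\sqrt{\beta}}{\sqrt{\alpha}}\sin(\sqrt{\alpha}(x-kl))$ for $kl\le x<kl+l_1$ and $f^n_{\alpha,\beta}(x)=-\sin(\sqrt{\beta}(x-kl-l_1))$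 for $kl+l_1\le x<(k+1)l$; if $\beta>n^2>\alpha$, then $f^n_{\alpha,\beta}(x)=\sin(\sqrt{\alpha}(x-kl))$ for $kl\le x<kl+l_1$ and $f^n_{\alpha,\beta}(x)=-\frac{\sqrt{\alpha}}{\sqrt{\beta}}\sin(\sqrt{\beta}(x-kl-l_1))$ for $kl+l_1\le x<(k+1)l$. For $n=1$, $f^1_{\alpha,\beta}(x)=\sin x$. Fučík system: a sequence $F_{\alpha,\beta}=\{f^n_{\alpha(n),\beta(n)}\}_{n\in\mathbb{N}}$ of normalized Fučík eigenfunctions, where $\alpha,\beta:\mathbb{N}\to\mathbb{R}$ satisfy $\alpha(1)=\beta(1)=1$ and $(\alpha(n),\beta(n))\in\Gamma_n$ for every $n\ge2$. Riesz basis: a system $\{\psi_n\}_{n\in\mathbb{N}}$ in $L^2(0,\pi)$ that is complete (its linear span is dense in $L^2(0,\pi)$) and for which there are constants $c,C>0$ with $c\sum_{n=1}^N|a_n|^2\le\|\sum_{n=1}^N a_n\psi_n\|^2\le C\sum_{n=1}^N|a_n|^2$ for all $N\in\mathbb{N}$ and all scalars $a_1,\dots,a_N$, where $\|\cdot\|$ is the standard norm of $L^2(0,\pi)$. *)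

(* Defs.v *)
From HB Require Import structures.
From mathcomp Require Import all_boot all_order all_algebra.
From mathcomp Require Import all_classical all_reals all_analysis.

Set Implicit Arguments.
Unset Strict Implicit.
Unset Printing Implicit Defensive.
Import Order.TTheory GRing.Theory Num.Theory.
Import numFieldNormedType.Exports.
Local Open Scope classical_set_scope.
Local Open Scope ring_scope.

(* Sequences indexed by the positive integers are functions on [nat] whose value
   at 0 is never used. *)

Section fucik.
Context {R : realType}.
Implicit Types (a b x y : R) (u f : R -> R) (n : nat).

Definition Gamma n : set (R * R) :=
  [set p | [/\ 0 < p.1, 0 < p.2 &
    if odd n then
      (n%:R + 1) / 2 * (pi / Num.sqrt p.1) +
      (n%:R - 1) / 2 * (pi / Num.sqrt p.2) = pi
    else
      n%:R / 2 * (pi / Num.sqrt p.1) + n%:R / 2 * (pi / Num.sqrt p.2) = pi]].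

(* Functions on [0, pi] are represented by functions on R whose values outside
   [0, pi] are irrelevant; boundary regularity is therefore one-sided. *)
Definition C2_on_0pi u :=
  {within `[0, pi], continuous u} /\
  {in `]0, pi[, forall x, [/\ derivable u x 1, derivable (u^`())%classic x 1 &
                              {for x, continuous (u^`(2))%classic}]}.

Definition fucik_solution a b u :=
  [/\ C2_on_0pi u,
      {in `]0, pi[, forall x, - (u^`(2))%classic x = a * u^\+ x - b * u^\- x},
      u 0 = 0 & u pi = 0].

Definition right_derivative_at0 u (d : R) :=
  (u h - u 0) / h @[h --> 0^'+] --> d.

(* [sup] is 0 on unbounded sets, so the last clause does say that the least
   upper bound exists and is 1. *)
Definition normalized_fucik_eigenfunction n a b f :=
  if n == 1%N then {in `[0, pi], f =1 sin}
  else [/\ fucik_solution a b f,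
           exists2 d : R, 0 < d & right_derivative_at0 f d
         & sup [set `|f x| | x in `[0, pi]] = 1].

Definition fucik_system (alpha beta : nat -> R) (F : nat -> R -> R) :=
  [/\ alpha 1%N = 1, beta 1%N = 1,
      forall n, (2 <= n)%N -> Gamma n (alpha n, beta n)
    & forall n, (1 <= n)%N ->
        normalized_fucik_eigenfunction n (alpha n) (beta n) (F n)].

Definition fucik_C n x y : R :=
  if ~~ odd n then
    4 * (3 + pi ^+ 2) * pi / 9 *
      (Num.max (Num.sqrt x) (Num.sqrt y) / n%:R - 1) ^+ 2
  else if y <= x then
    4 * pi * (n%:R ^+ 2 * (n%:R ^+ 2 + 1) / (n%:R - 1) ^+ 4) *
      (Num.sqrt x / n%:R - 1) ^+ 2
  else
    5 * pi * (n%:R ^+ 2 * (n%:R ^+ 2 + 1) / (n%:R + 1) ^+ 4) *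
      (Num.sqrt y / n%:R - 1) ^+ 2.

End fucik.

Section L2_0pi.
Context {R : realType}.
Implicit Types (f g : R -> R) (psi : nat -> R -> R).

(* L^2(0, pi), with elements of L^2(0, pi) extended by zero to R. *)
Definition L2_0pi f :=
  f \_ `]0, pi[ \in Lfun (@lebesgue_measure R) 2%:E.

Definition L2norm_0pi f : \bar R :=
  ('N[@lebesgue_measure R]_2%:E[EFin \o (f \_ `]0%R, pi[)])%E.

Definition lincomb psi (N : nat) (a : nat -> R) : R -> R :=
  fun x => \sum_(1 <= n < N.+1) a n * psi n x.

Definition complete_system psi :=
  forall g, L2_0pi g -> forall e : R, 0 < e ->
    exists N (a : nat -> R),
      (L2norm_0pi (fun x => (g x - lincomb psi N a x)%R) < e%:E)%E.

Definition riesz_basis psi :=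
  [/\ forall n, (1 <= n)%N -> L2_0pi (psi n),
      complete_system psi &
      exists c C : R, [/\ 0 < c, 0 < C & forall N (a : nat -> R),
        ((c * \sum_(1 <= n < N.+1) `|a n| ^+ 2)%:E
           <= L2norm_0pi (lincomb psi N a) ^+ 2 <=
         (C * \sum_(1 <= n < N.+1) `|a n| ^+ 2)%:E)%E]].

End L2_0pi.

(* Main.v *)
Require Import Defs.
From mathcomp Require Import all_boot all_order all_algebra.
From mathcomp Require Import all_classical all_reals all_analysis.
From mathcomp Require Import measurable_realfun ring lra.
Set Implicit Arguments.
Unset Strict Implicit.
Unset Printing Implicit Defensive.
Import Order.TTheory GRing.Theory Num.Theory.
Import numFieldNormedType.Exports.
Local Open Scope classical_set_scope.
Local Open Scope ring_scope.

(* The functions sin (n x) are orthogonal with squared norm pi / 2 and complete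
   in L^2(0, pi), so by the Paley-Wiener argument a system F with
   sum_n |F_n - sin (n .)|^2 < pi / 2 is a Riesz basis.  Completeness of the
   sines: f is approximated by a continuous g with |g| <= k sin, and g / sin, as
   a function of cos x, by Bernstein polynomials; sin times a polynomial in cos
   is a finite sine sum.
   By uniqueness for the initial value problem, F_n is a sequence of sine bumps:
   on each bump it is C sin (theta x) with 0 < C <= 1 and a continuous, piecewise
   affine phase theta.  Since
     (C sin s - sin t)^2 <= |C e^(i s) - e^(i t)|^2 <= (1 - C)^2 + C (s - t)^2,
   the distance |F_n - sin (n .)|^2 is estimated by integrating the square of the
   piecewise affine function theta x - n x, which vanishes at 0 and pi. *)

(** * The seminorm of L^2(0, pi) *)

(** Why pi / 2: by Cauchy-Schwarz, |sum a_n (F_n - sin (n .))|^2 <= (sum a_n^2) (sum |F_n - sin (n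
    .)|^2), and sum a_n^2 equals |sum a_n sin (n .)|^2 / (pi / 2). So the perturbation is smaller
    than the sine sum by a fixed factor below 1. An eigenfunction is known only through its
    equation, the sign of its initial slope and its sup norm, so its shape has to be recovered
    first. The phase estimate then replaces integrals of products of sines by integrals of quadratic
    polynomials. For even n the phase error returns to 0 after each pair of bumps. For odd n one
    positive bump stays unpaired and the error drifts by |l2 - l1| per pair, which is why the odd
    constants have another form. *)

Section L2.
Context {R : realType}.
Implicit Types (f g : R -> R) (a : R).
Let mu := @lebesgue_measure R.
Let I : set R := `]0, pi[.

(** [fine] sends an infinite norm to 0, so this is the norm only on [L2_0pi]; hence the membership
    hypotheses below. *)
Definition nrm f : R := fine (L2norm_0pi f).

Let two1 : (1 <= 2%:E :> \bar R)%E. Proof. by rewrite lee_fin ler1n. Qed.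

Lemma L2_0piD f g : L2_0pi f -> L2_0pi g -> L2_0pi (f \+ g).
Proof.
move=> Lf Lg; rewrite /L2_0pi.
have -> : (f \+ g) \_ `]0, pi[ = f \_ `]0, pi[ + g \_ `]0, pi[.
  by apply/funext => x; rewrite /patch fctE; case: ifP => //; rewrite addr0.
exact: rpredD.
Qed.

Lemma L2_0piZ a f : L2_0pi f -> L2_0pi (a \*: f).
Proof.
move=> Lf; rewrite /L2_0pi.
have -> : (a \*: f) \_ `]0, pi[ = a \o* (f \_ `]0, pi[).
  apply/funext => x; rewrite /patch/=; case: ifP => //; last by rewrite mul0r.
  by move=> _; rewrite mulrC.
by apply: Lfun_scale => //; rewrite ler1n.
Qed.

Lemma L2norm_0piE f : L2_0pi f -> L2norm_0pi f = (nrm f)%:E.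
Proof.
move=> Lf; rewrite /nrm fineK// ge0_fin_numE ?Lnorm_ge0//.
by move/andP: Lf => [_]; rewrite inE.
Qed.

Lemma nrm_ge0 f : 0 <= nrm f.
Proof. by rewrite fine_ge0// Lnorm_ge0. Qed.

Lemma ler_nrmD f g : L2_0pi f -> L2_0pi g -> nrm (f \+ g) <= nrm f + nrm g.
Proof.
move=> Lf Lg; rewrite -lee_fin EFinD -!L2norm_0piE//; last exact: L2_0piD.
rewrite /L2norm_0pi.
have -> : (f \+ g) \_ `]0, pi[ = f \_ `]0, pi[ \+ g \_ `]0, pi[.
  by apply/funext => x; rewrite /patch/=; case: ifP => //; rewrite addr0.
apply: minkowski_EFin; rewrite ?ler1n//.
  by case/andP: Lf; rewrite inE.
by case/andP: Lg; rewrite inE.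
Qed.

Lemma nrmZ a f : L2_0pi f -> nrm (a \*: f) = `|a| * nrm f.
Proof.
move=> Lf; apply: EFin_inj; rewrite EFinM -!L2norm_0piE//; last exact: L2_0piZ.
rewrite /L2norm_0pi.
have -> : (a \*: f) \_ `]0, pi[ = a \*: (f \_ `]0, pi[).
  by apply/funext => x; rewrite /patch/=; case: ifP => //; rewrite scaler0.
by rewrite (@LnormZ _ _ _ _ _ two1 (Lfun_Sub two1 Lf)).
Qed.

Lemma L2_0pi_integrable_sqr f : L2_0pi f ->
  mu.-integrable I (EFin \o (fun x => f x ^+ 2)).
Proof.
move=> /Lfun2_integrable_sqr; rewrite -/mu => h.
apply/integrable_mkcond; first exact: measurable_itv.
apply: (eq_integrable measurableT _ _ _ h) => x _ /=.
by rewrite /patch; case: ifP => // _; rewrite expr0n.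
Qed.

Lemma nrm_sqr f : L2_0pi f ->
  (nrm f ^+ 2)%:E = (\int[mu]_(x in I) (f x ^+ 2)%:E)%E.
Proof.
move=> Lf; rewrite -powR_mulrn ?nrm_ge0// -poweR_EFin -L2norm_0piE//.
rewrite /L2norm_0pi poweR_Lnorm ?pnatr_eq0//.
rewrite [RHS]integral_mkcond; apply: eq_integral => x _ /=.
rewrite powR_mulrn ?real_normK ?num_real// /patch; case: ifP => //.
by rewrite expr0n.
Qed.

Lemma L2_0pi_measurable_bounded f (M : R) : measurable_fun I f ->
  (forall x, I x -> `|f x| <= M) -> L2_0pi f.
Proof.
move=> mf bf; apply/andP; split; rewrite inE/=.
  by apply/(measurable_restrictT _ _).1.
rewrite /finite_norm unlock /Lnorm poweR_lty//.
apply: (@le_lt_trans _ _ (\int[mu]_(x in I) (M ^+ 2)%:E)%E).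
  rewrite [leRHS]integral_mkcond; apply: ge0_le_integral => //.
  - by move=> x _; exact: poweR_ge0.
  - apply/measurable_EFinP.
    apply: (@measurableT_comp _ _ _ _ _ _ (fun x : R => x `^ 2)) => //.
    apply: measurableT_comp => //.
    by apply/(measurable_restrictT _ _).1.
  - apply: (measurable_restrictT _ _).1; [exact: measurable_itv|exact: measurable_cst].
  - move=> x _; rewrite /= /patch; case: ifPn.
      rewrite inE => Ix; rewrite powR_mulrn// lee_fin.
      by rewrite lerXn2r ?nnegrE// ?(le_trans _ (bf _ Ix)) ?bf.
    by rewrite normr0 powR0.
rewrite integral_cst//=; last exact: measurable_itv.
by rewrite lebesgue_measure_itv/= lte_fin pi_gt0 -EFinB -EFinM ltry.
Qed.

End L2.

Section lincombs.
Context {R : realType}.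
Implicit Types (f g : R -> R) (psi : nat -> R -> R) (a b : nat -> R).

Lemma L2_0pi0 : L2_0pi (fun=> 0 : R).
Proof.
apply: (@L2_0pi_measurable_bounded _ _ 0); first exact: measurable_cst.
by move=> x _; rewrite normr0.
Qed.

Lemma L2_0piB f g : L2_0pi f -> L2_0pi g -> L2_0pi (f \- g).
Proof.
move=> Lf Lg; have := L2_0piD Lf (L2_0piZ (-1) Lg).
by congr L2_0pi; apply/funext => x /=; rewrite scaleN1r.
Qed.

Lemma ler_nrmB f g : L2_0pi f -> L2_0pi g -> nrm (f \- g) <= nrm f + nrm g.
Proof.
move=> Lf Lg; have := ler_nrmD Lf (L2_0piZ (-1) Lg).
rewrite nrmZ// normrN1 mul1r; congr (nrm _ <= _).
by apply/funext => x /=; rewrite scaleN1r.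
Qed.

Lemma L2_0pi_lincomb psi N a : (forall n, (1 <= n)%N -> L2_0pi (psi n)) ->
  L2_0pi (lincomb psi N a).
Proof.
move=> Lpsi; elim: N => [|N IH].
  have := L2_0pi0; congr L2_0pi; apply/funext => x.
  by rewrite /lincomb big_geq.
have := L2_0piD IH (L2_0piZ (a N.+1) (Lpsi N.+1 isT)).
by congr L2_0pi; apply/funext => x; rewrite /lincomb [in RHS]big_nat_recr.
Qed.

Lemma nrm_lincomb_le psi N a : (forall n, (1 <= n)%N -> L2_0pi (psi n)) ->
  nrm (lincomb psi N a) <= \sum_(1 <= n < N.+1) `|a n| * nrm (psi n).
Proof.
move=> Lpsi; elim: N => [|N IH].
  rewrite big_geq//; have := nrmZ 0 L2_0pi0; rewrite normr0 mul0r.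
  move=> <-; rewrite le_eqVlt; apply/orP; left; apply/eqP; congr nrm.
  by apply/funext => x /=; rewrite /lincomb big_geq// scale0r.
rewrite big_nat_recr//= -nrmZ; last exact: Lpsi.
have -> : lincomb psi N.+1 a = lincomb psi N a \+ (a N.+1 \*: psi N.+1).
  by apply/funext => x; rewrite /lincomb big_nat_recr.
apply: (le_trans (ler_nrmD _ _)).
- exact: L2_0pi_lincomb.
- exact/L2_0piZ/Lpsi.
- by rewrite lerD2r.
Qed.

Lemma lincombD psi N a M b : exists K c,
  lincomb psi N a \+ lincomb psi M b = lincomb psi K c.
Proof.
have pad N' M' (e : nat -> R) : (N' <= M')%N ->
    lincomb psi N' e = lincomb psi M' (fun n => if (n <= N')%N then e n else 0).
  move=> NM; apply/funext => x; rewrite /lincomb [RHS](big_cat_nat (n:=N'.+1))//=.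
  rewrite [X in _ = _ + X]big1_seq ?addr0; last first.
    move=> i; rewrite mem_index_iota => /andP[_ /andP[+ _]].
    by rewrite leqNgt ltnS => /negbTE ->; rewrite mul0r.
  by apply: eq_big_nat => i /andP[_]; rewrite ltnS => ->.
rewrite (pad N (maxn N M)) ?leq_maxl// (pad M (maxn N M)) ?leq_maxr//.
do 2 eexists; apply/funext => x; rewrite /lincomb/= -big_split/=.
by under eq_bigr do rewrite -mulrDl; reflexivity.
Qed.

Lemma sum_cauchy_schwarz a b N :
  (\sum_(1 <= n < N) a n * b n) ^+ 2 <=
  (\sum_(1 <= n < N) a n ^+ 2) * (\sum_(1 <= n < N) b n ^+ 2).
Proof.
elim: N => [|N IH]; first by rewrite !big_geq// expr0n mulr0.
case: N IH => [|N] IH; first by rewrite !big_geq// expr0n mulr0.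
rewrite (big_nat_recr N.+1)//= (big_nat_recr N.+1 _ (fun n => a n ^+ 2))//=.
rewrite (big_nat_recr N.+1 _ (fun n => b n ^+ 2))//=.
have A0 : 0 <= \sum_(1 <= n < N.+1) a n ^+ 2 by apply: sumr_ge0 => i _; exact: sqr_ge0.
have B0 : 0 <= \sum_(1 <= n < N.+1) b n ^+ 2 by apply: sumr_ge0 => i _; exact: sqr_ge0.
move: IH A0 B0; set s := \sum_(1 <= n < N.+1) a n * b n.
set A := \sum_(1 <= n < N.+1) a n ^+ 2; set B := \sum_(1 <= n < N.+1) b n ^+ 2.
move: (a N.+1) (b N.+1) => x y sAB A0 B0.
(* The cross term of the new square: its square is at most 4 A B x^2 y^2, which (A y^2 - B x^2)^2 >=
   0 bounds by (A y^2 + B x^2)^2. *)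
have h : 2 * s * x * y <= A * y ^+ 2 + B * x ^+ 2.
  apply: (le_trans (ler_norm _)); rewrite -ler_sqr ?nnegrE//; last first.
    by apply: addr_ge0; apply: mulr_ge0 => //; exact: sqr_ge0.
  rewrite real_normK ?num_real//.
  have h1 : s ^+ 2 * (x * y) ^+ 2 <= A * B * (x * y) ^+ 2.
    by apply: ler_wpM2r => //; exact: sqr_ge0.
  have h2 : 0 <= (A * y ^+ 2 - B * x ^+ 2) ^+ 2 by exact: sqr_ge0.
  nra.
nra.
Qed.

End lincombs.

(** * Paley-Wiener stability *)

Section paley_wiener.
Context {R : realType}.
Variables (phi psi : nat -> R -> R) (C : nat -> R) (kappa S : R).
Hypotheses (Lphi : forall n, (1 <= n)%N -> L2_0pi (phi n))
  (Lpsi : forall n, (1 <= n)%N -> L2_0pi (psi n))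
  (complete_phi : complete_system phi)
  (orth_phi : forall N a, nrm (lincomb phi N a) ^+ 2 =
    kappa * \sum_(1 <= n < N.+1) a n ^+ 2)
  (dist_psi : forall n, (1 <= n)%N -> nrm (psi n \- phi n) ^+ 2 <= C n)
  (sum_C : forall N, \sum_(1 <= n < N.+1) C n <= S)
  (S_lt : S < kappa).

Let S_ge0 : 0 <= S. Proof. by have := sum_C 0; rewrite big_geq. Qed.
Let kappa_gt0 : 0 < kappa. Proof. exact: le_lt_trans S_lt. Qed.
Let lam := Num.sqrt (S / kappa).
Let lam_ge0 : 0 <= lam. Proof. exact: sqrtr_ge0. Qed.
Let lam_lt1 : lam < 1.
Proof.
rewrite -[ltRHS](@sqrtr1 R) ltr_sqrt//.
by rewrite ltr_pdivrMr// mul1r.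
Qed.

Let d n := psi n \- phi n.
Let Ld n : (1 <= n)%N -> L2_0pi (d n).
Proof. by move=> n1; apply: L2_0piB; [exact: Lpsi|exact: Lphi]. Qed.

Let lincomb_psi N a : lincomb psi N a = lincomb phi N a \+ lincomb d N a.
Proof.
apply/funext => x; rewrite /lincomb/= -big_split/=.
by apply: eq_bigr => i _; rewrite -mulrDr /d/= addrC subrK.
Qed.

(** Cauchy-Schwarz separates the coefficients, which [orth_phi] turns into the norm of the [phi] sum
    divided by [kappa], from the distances, which sum to at most [S]. *)
Let nrm_d N a : nrm (lincomb d N a) <= lam * nrm (lincomb phi N a).
Proof.
apply: (le_trans (nrm_lincomb_le N a Ld)).
rewrite -ler_sqr ?nnegrE//; last 2 first.
- by apply: sumr_ge0 => i _; rewrite mulr_ge0// nrm_ge0.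
- by rewrite mulr_ge0// nrm_ge0.
apply: (le_trans (sum_cauchy_schwarz (fun n => `|a n|) (fun n => nrm (d n)) _)).
rewrite exprMn orth_phi sqr_sqrtr; last by rewrite divr_ge0// ltW.
rewrite mulrA divfK ?gt_eqF// mulrC.
under [X in _ * X <= _]eq_bigr do rewrite real_normK ?num_real//.
apply: ler_wpM2r; first by apply: sumr_ge0 => i _; exact: sqr_ge0.
apply: le_trans (sum_C N); apply: ler_sum_nat => i /andP[i1 _].
exact: dist_psi.
Qed.

(* Each correction by a combination of the psi n shrinks the residual by a fixed
   factor < 1, so density needs no completeness of L^2. *)
Let reduce g : L2_0pi g -> exists N a,
  nrm (g \- lincomb psi N a) <= (1 + lam) / 2 * nrm g.
Proof.
(* Completeness needs a positive tolerance, proportional here to [nrm g]; a residual of norm 0 is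
   left alone. *)
move=> Lg; have [g0|g0] := eqVneq (nrm g) 0.
  exists 0%N, (fun=> 0); rewrite g0 mulr0 -g0 le_eqVlt; apply/orP; left.
  by apply/eqP; congr nrm; apply/funext => x; rewrite /lincomb/= big_geq// subr0.
have gp : 0 < nrm g by rewrite lt_def g0 nrm_ge0.
(* Chosen so that eta + lam (nrm g + eta), the bound obtained below, is exactly (1 + lam) / 2 times
   [nrm g]. *)
pose eta := (1 - lam) / (2 * (1 + lam)) * nrm g.
have l1 : 0 < 1 + lam by rewrite ltr_pwDl.
have eta0 : 0 < eta by rewrite mulr_gt0// divr_gt0 ?subr_gt0// mulr_gt0.
have [N [a]] := complete_phi Lg eta0.
have LP : L2_0pi (lincomb phi N a) by exact: L2_0pi_lincomb.
have LgP := L2_0piB Lg LP.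
rewrite L2norm_0piE// lte_fin => gP; exists N, a.
have -> : g \- lincomb psi N a = (g \- lincomb phi N a) \- lincomb d N a.
  by apply/funext => x; rewrite lincomb_psi/= opprD addrA.
apply: (le_trans (ler_nrmB LgP (L2_0pi_lincomb N a Ld))).
have := nrm_d N a.
have : nrm (lincomb phi N a) <= nrm g + eta.
  apply: le_trans (_ : nrm g + nrm (g \- lincomb phi N a) <= _); last first.
    by rewrite lerD2l ltW.
  apply: le_trans (ler_nrmB Lg LgP); rewrite le_eqVlt; apply/orP; left.
  by apply/eqP; congr nrm; apply/funext => x /=; rewrite opprB addrC subrK.
move=> /(ler_wpM2l lam_ge0) h1 h2.
rewrite (le_trans (lerD (ltW gP) (le_trans h2 h1)))//.
have : eta * (1 + lam) = (1 - lam) / 2 * nrm g by rewrite /eta; field; rewrite gt_eqF.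
rewrite -/(g \- _); nra.
Qed.

Let iterate g k : L2_0pi g -> exists N a,
  nrm (g \- lincomb psi N a) <= ((1 + lam) / 2) ^+ k * nrm g.
Proof.
move=> Lg; elim: k => [|k [N [a IH]]].
  exists 0%N, (fun=> 0); rewrite mul1r le_eqVlt; apply/orP; left.
  by apply/eqP; congr nrm; apply/funext => x; rewrite /lincomb/= big_geq// subr0.
have [M [b hb]] := reduce (L2_0piB Lg (L2_0pi_lincomb N a Lpsi)).
have [K [c hc]] := lincombD psi N a M b.
exists K, c; rewrite -hc exprS -mulrA.
apply: le_trans (_ : (1 + lam) / 2 * nrm (g \- lincomb psi N a) <= _).
  rewrite (le_trans _ hb)// le_eqVlt; apply/orP; left.
  by apply/eqP; congr nrm; apply/funext => x /=; rewrite opprD addrA.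
by apply: ler_wpM2l => //; rewrite divr_ge0// addr_ge0.
Qed.

Theorem paley_wiener : riesz_basis psi.
Proof.
split => //.
- move=> g Lg e e0.
  have mu0 : 0 <= (1 + lam) / 2 by rewrite divr_ge0// addr_ge0.
  have mu1 : `|(1 + lam) / 2| < 1.
    rewrite ger0_norm// ltr_pdivrMr// mul1r; move: lam_lt1; lra.
  (* The [+ 1] keeps the divisor positive when [nrm g] is 0. *)
  have e1 : 0 < e / (nrm g + 1) by rewrite divr_gt0// ltr_pwDr// nrm_ge0.
  have /cvgrPdist_lt/(_ _ e1)[k _ /(_ k (leqnn k))] := cvg_expr mu1.
  rewrite sub0r normrN ger0_norm ?exprn_ge0//= => hk.
  have [N [a hN]] := iterate k Lg; exists N, a.
  rewrite L2norm_0piE; last exact/L2_0piB/L2_0pi_lincomb.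
  rewrite lte_fin (le_lt_trans hN)//.
  have g1 : 0 < nrm g + 1 by rewrite ltr_pwDr// nrm_ge0.
  move: hk; rewrite ltr_pdivlMr//; apply: le_lt_trans.
  by apply: ler_wpM2l; rewrite ?exprn_ge0// lerDl.
(* The triangle inequality puts the norm of a [psi] sum between 1 - lam and 1 + lam times that of
   the [phi] sum. *)
- exists ((1 - lam) ^+ 2 * kappa), ((1 + lam) ^+ 2 * kappa).
  have l1 : 0 < 1 - lam by rewrite subr_gt0.
  have l2 : 0 < 1 + lam by rewrite ltr_pwDl.
  split; rewrite ?mulr_gt0 ?exprn_gt0// => N a.
  have Lphia := L2_0pi_lincomb N a Lphi; have Lda := L2_0pi_lincomb N a Ld.
  have Lpsia := L2_0pi_lincomb N a Lpsi.
  under eq_bigr do rewrite real_normK ?num_real//.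
  rewrite -2!(mulrA _ kappa) -orth_phi -!exprMn L2norm_0piE// -EFin_expe !lee_fin.
  rewrite !ler_sqr ?nnegrE ?mulr_ge0 ?nrm_ge0 ?(ltW l1) ?(ltW l2)//.
  have := nrm_d N a => hd; apply/andP; split.
    have : nrm (lincomb phi N a) <= nrm (lincomb psi N a) + nrm (lincomb d N a).
      apply: le_trans (ler_nrmB Lpsia Lda); rewrite le_eqVlt; apply/orP; left.
      by apply/eqP; congr nrm; apply/funext => x; rewrite lincomb_psi/= addrK.
    nra.
  rewrite lincomb_psi; apply: (le_trans (ler_nrmD Lphia Lda)); nra.
Qed.

End paley_wiener.

(** * Sine sums *)

Section calculus.
Context {R : realType}.
Implicit Types (f F : R -> R) (a b c k x : R).
Let mu := @lebesgue_measure R.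

Lemma is_derive_affine k c x : is_derive x 1 (fun y : R => k * y + c) k.
Proof. by apply: is_derive_eq; rewrite addr0 /GRing.scale/= mulr1. Qed.

Lemma is_deriveMl k f df x : is_derive x 1 f df ->
  is_derive x 1 (fun y => k * f y) (k * df).
Proof. exact: is_deriveZ. Qed.

Lemma eq_is_derive f g df dg x : is_derive x 1 f df -> f =1 g -> df = dg ->
  is_derive x 1 g dg.
Proof. by move=> h /funext <- <-. Qed.

Lemma is_derive_sin_affine k c x :
  is_derive x 1 (fun y => sin (k * y + c)) (k * cos (k * x + c)).
Proof.
rewrite mulrC; apply: (@is_derive1_comp _ sin (fun y => k * y + c)).
exact: is_derive_affine.
Qed.

Lemma is_derive_cos_affine k c x :
  is_derive x 1 (fun y => cos (k * y + c)) (- k * sin (k * x + c)).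
Proof.
rewrite mulNr mulrC -mulNr; apply: (@is_derive1_comp _ cos (fun y => k * y + c)).
exact: is_derive_affine.
Qed.

Lemma is_derive_sum_nat (F f : nat -> R -> R) m n x :
  (forall i, (m <= i)%N -> is_derive x 1 (F i) (f i x)) ->
  is_derive x 1 (fun y => \sum_(m <= i < n) F i y) (\sum_(m <= i < n) f i x).
Proof.
move=> dF; elim: n => [|n IH].
  rewrite big_geq//; under eq_fun do rewrite big_geq//.
  exact: is_derive_cst.
have [nm|mn] := ltnP n m.
  rewrite big_geq//; under eq_fun do rewrite big_geq//.
  exact: is_derive_cst.
rewrite big_nat_recr//=; under eq_fun do rewrite big_nat_recr//=.
by apply: is_deriveD; exact: dF.
Qed.

Lemma is_derive_continuous f (df : R -> R) : (forall x, is_derive x 1 f (df x)) -> continuous f.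
Proof. by move=> h x; apply/differentiable_continuous/derivable1_diffP; have [] := h x. Qed.

Lemma integral_itv_is_derive F f a b : a <= b ->
  (forall x, is_derive x 1 F (f x)) -> continuous f ->
  (\int[mu]_(x in `[a, b]) (f x)%:E = (F b - F a)%:E)%E.
Proof.
rewrite le_eqVlt => /predU1P[<-{b} _ _|ab dF cf].
  by rewrite set_itv1 integral_set1 subrr.
have cF := is_derive_continuous dF.
rewrite (continuous_FTC2 ab (F := F)) ?EFinB//.
- exact: continuous_subspaceT.
- split.
  + by move=> x _; have [] := dF x.
  + exact/cvg_at_right_filter/cF.
  + exact/cvg_at_left_filter/cF.
- by move=> x _; rewrite derive1E; have [] := dF x.
Qed.

Lemma integral_itv_oo f a b : measurable_fun `]a, b[ f ->
  (\int[mu]_(x in `]a, b[) (f x)%:E = \int[mu]_(x in `[a, b]) (f x)%:E)%E.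
Proof.
move=> /measurable_EFinP mf.
rewrite integral_itv_bndo_bndc// integral_itv_obnd_cbnd//.
by move/emeasurable_fun_itv_bndo_bndcP: mf.
Qed.

Lemma integral_oo_is_derive F f a b : a <= b ->
  (forall x, is_derive x 1 F (f x)) -> continuous f ->
  (\int[mu]_(x in `]a, b[) (f x)%:E = (F b - F a)%:E)%E.
Proof.
move=> ab dF cf; rewrite integral_itv_oo; first exact: integral_itv_is_derive.
by apply: measurable_funTS; exact: continuous_measurable_fun.
Qed.

Lemma sin_natpi n : sin (n%:R * pi) = 0 :> R.
Proof.
by elim: n => [|n IH]; rewrite ?mul0r ?sin0// -natr1 mulrDl mul1r sinDpi IH oppr0.
Qed.

Lemma cos_natpi n : cos (n%:R * pi) = (-1) ^+ n :> R.
Proof.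
elim: n => [|n IH]; rewrite ?mul0r ?cos0// -natr1 mulrDl mul1r cosDpi IH.
by rewrite exprS mulN1r.
Qed.

End calculus.

Section sines.
Context {R : realType}.
Let mu := @lebesgue_measure R.

Definition sines (n : nat) (x : R) := sin (n%:R * x).

Lemma is_derive_sines n (x : R) : is_derive x 1 (sines n) (n%:R * cos (n%:R * x)).
Proof.
have := is_derive_sin_affine n%:R 0 x; rewrite addr0.
by under eq_fun do rewrite addr0.
Qed.

Lemma continuous_sines n : continuous (sines n).
Proof. exact: is_derive_continuous (is_derive_sines n). Qed.

Lemma L2_0pi_sines n : L2_0pi (sines n).
Proof.
apply: (@L2_0pi_measurable_bounded _ _ 1); last by move=> x _; exact: sin_max.
apply: measurable_funTS; apply: continuous_measurable_fun.
exact: continuous_sines.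
Qed.

(** Antiderivative of sin (i x) sin (j x) = (cos ((i - j) x) - cos ((i + j) x)) / 2. For i = j the
    first cosine is constant and the general quotient would divide by 0. *)
Let prim (i j : nat) (x : R) : R :=
  (if i == j then 2^-1 * x else sin ((i%:R - j%:R) * x) / (2 * (i%:R - j%:R)))
  - sin ((i%:R + j%:R) * x) / (2 * (i%:R + j%:R)).

Let is_derive_prim i j (x : R) : (1 <= i)%N -> (1 <= j)%N ->
  is_derive x 1 (prim i j) (sines i x * sines j x).
Proof.
move=> i1 j1.
have dsin (k : R) : k != 0 ->
    is_derive x 1 (fun y => sin (k * y) / (2 * k)) (cos (k * x) / 2).
  move=> k0; apply: eq_is_derive (is_deriveMl (2 * k)^-1 (is_derive_sin_affine k 0 x)) _ _.
    by move=> y; rewrite addr0 mulrC.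
  by rewrite addr0; field.
have -> : sines i x * sines j x =
    cos ((i%:R - j%:R) * x) / 2 - cos ((i%:R + j%:R) * x) / 2.
  by rewrite /sines mulrBl mulrDl cosB cosD; field.
apply: is_deriveB; last first.
  by apply: dsin; rewrite -natrD pnatr_eq0; case: (i) i1.
rewrite /prim; case: eqP => [->|/eqP ij].
  rewrite subrr mul0r cos0 mul1r.
  by apply: eq_is_derive (is_derive_affine 2^-1 0 x) _ _ => // y; rewrite addr0.
by apply: dsin; rewrite subr_eq0 eqr_nat.
Qed.

Let prim_pi i j : prim i j pi - prim i j 0 = if i == j then pi / 2 else 0.
Proof.
have sD : sin ((i%:R + j%:R) * pi) = 0 :> R by rewrite -natrD sin_natpi.
have sB : sin ((i%:R - j%:R) * pi) = 0 :> R.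
  by rewrite mulrBl sinB !sin_natpi mul0r mulr0 subrr.
rewrite /prim sD sB !mulr0 sin0 !mul0r.
by case: eqP => _; rewrite !subr0// mulrC.
Qed.

Lemma nrm_lincomb_sines N a : nrm (lincomb sines N a) ^+ 2 =
  pi / 2 * \sum_(1 <= n < N.+1) a n ^+ 2.
Proof.
apply: EFin_inj; rewrite nrm_sqr; last by apply: L2_0pi_lincomb => n _; exact: L2_0pi_sines.
(* Antiderivative of the squared sum, expanded as a double sum; only its diagonal terms differ
   between 0 and pi. *)
pose G x := \sum_(1 <= i < N.+1) \sum_(1 <= j < N.+1) a i * a j * prim i j x.
have cl : continuous (lincomb sines N a).
  apply: (@is_derive_continuous _ _ (fun x => \sum_(1 <= i < N.+1) a i * (i%:R * cos (i%:R * x)))) => x.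
  apply: (@is_derive_sum_nat _ (fun i y => a i * sines i y)
    (fun i y => a i * (i%:R * cos (i%:R * y)))) => i _.
  exact: (is_deriveMl (a i) (is_derive_sines i x)).
have dG (x : R) : is_derive x 1 G (lincomb sines N a x ^+ 2).
  have -> : lincomb sines N a x ^+ 2 =
      \sum_(1 <= i < N.+1) \sum_(1 <= j < N.+1) a i * a j * (sines i x * sines j x).
    rewrite expr2 {1}/lincomb mulr_suml; apply: eq_bigr => i _.
    by rewrite /lincomb mulr_sumr; apply: eq_bigr => j _; ring.
  apply: (@is_derive_sum_nat _
    (fun i x => \sum_(1 <= j < N.+1) a i * a j * prim i j x)
    (fun i x => \sum_(1 <= j < N.+1) a i * a j * (sines i x * sines j x))) => i i1.
  apply: (@is_derive_sum_nat _ (fun j x => a i * a j * prim i j x)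
    (fun j x => a i * a j * (sines i x * sines j x))) => j j1.
  exact: (is_deriveMl (a i * a j) (is_derive_prim x i1 j1)).
rewrite (integral_oo_is_derive (pi_ge0 R) dG); last first.
  move=> x; apply: (@continuous_comp _ _ _ (lincomb sines N a) (fun y => y ^+ 2)).
    exact: cl.
  exact: exprn_continuous.
congr EFin; rewrite /G -sumrB mulr_sumr; apply: eq_big_nat => i iN.
rewrite -sumrB (bigD1_seq i)/= ?iota_uniq ?mem_index_iota//.
rewrite -mulrBr prim_pi eqxx big1 ?addr0; first by rewrite expr2 mulrC.
by move=> j ji; rewrite -mulrBr prim_pi eq_sym (negbTE ji) mulr0.
Qed.

End sines.

(** * Bernstein polynomials in cos x and the span of the sines *)

Section bernstein.
Context {R : realType}.

(* The Bernstein polynomial of phi : {0, ..., n} -> R, by Pascal's recursion; the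
   error bound of bern_approx, with its binomial mean and variance, then follows
   by a single induction on n. *)
Fixpoint bern n (p : R) (phi : nat -> R) : R :=
  if n is m.+1 then (1 - p) * bern m p phi + p * bern m p (fun k => phi k.+1)
  else phi 0%N.

(** The bound is e + K E (X - c)^2 for a binomial X. The centre [c] is free because the shift in the
    recursion moves it. *)
Lemma bern_approx n (p : R) phi y e K c : 0 <= p <= 1 ->
  (forall k, (k <= n)%N -> `|phi k - y| <= e + K * (k%:R - c) ^+ 2) ->
  `|bern n p phi - y| <= e + K * ((n%:R * p - c) ^+ 2 + n%:R * (p * (1 - p))).
Proof.
move=> /andP[p0 p1]; elim: n phi c => [|n IH] phi c hphi /=.
  by have := hphi 0%N isT; rewrite !mul0r addr0.
have h1 := IH phi c (fun k kn => hphi k (leqW kn)).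
(* Shifting [phi] by one index moves the centre from c to c - 1. *)
have /IH h2 : forall k, (k <= n)%N ->
    `|phi k.+1 - y| <= e + K * (k%:R - (c - 1)) ^+ 2.
  move=> k kn; apply: (le_trans (hphi k.+1 kn)).
  by rewrite -natr1 opprB addrA addrAC.
have -> : (1 - p) * bern n p phi + p * bern n p (fun k => phi k.+1) - y =
    (1 - p) * (bern n p phi - y) + p * (bern n p (fun k => phi k.+1) - y) by ring.
apply: (le_trans (ler_normD _ _)); rewrite !normrM (ger0_norm p0) ger0_norm ?subr_ge0//.
have q0 : 0 <= 1 - p by rewrite subr_ge0.
apply: (le_trans (lerD (ler_wpM2l q0 h1) (ler_wpM2l p0 h2))).
by rewrite le_eqVlt; apply/orP; left; apply/eqP; rewrite -natr1; ring.
Qed.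

Lemma bern_bounded n (p : R) phi M : 0 <= p <= 1 ->
  (forall k, (k <= n)%N -> `|phi k| <= M) -> `|bern n p phi| <= M.
Proof.
move=> p01 h; have := @bern_approx n p phi 0 M 0 0 p01.
by rewrite mul0r addr0 subr0; apply => k kn; rewrite subr0 mul0r addr0 h.
Qed.

Definition sine_span (f : R -> R) := exists N a, f = lincomb sines N a.

Lemma sine_span_sines n : sine_span (sines n).
Proof.
(* [lincomb] starts at index 1, but [sines 0] vanishes and is the empty sum; it arises from cos x
   sin x in [sine_span_cos]. *)
case: n => [|n].
  exists 0%N, (fun=> 0); apply/funext => x.
  by rewrite /lincomb big_geq// /sines mul0r sin0.
exists n.+1, (fun k => if k == n.+1 then 1 else 0); apply/funext => x.
rewrite /lincomb big_nat_recr//= eqxx mul1r big1_seq ?add0r// => i.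
rewrite mem_index_iota => /andP[_ /andP[_ iN]].
by rewrite (ltn_eqF iN) mul0r.
Qed.

Lemma sine_spanD f g : sine_span f -> sine_span g -> sine_span (f \+ g).
Proof. by move=> [N [a ->]] [M [b ->]]; exact: lincombD. Qed.

Lemma sine_spanZ k f : sine_span f -> sine_span (fun x => k * f x).
Proof.
move=> [N [a ->]]; exists N, (fun n => k * a n); apply/funext => x.
by rewrite /lincomb mulr_sumr; apply: eq_bigr => i _; rewrite mulrA.
Qed.

Lemma sine_span_sum (f : nat -> R -> R) N : (forall n, sine_span (f n)) ->
  sine_span (fun x => \sum_(1 <= n < N) f n x).
Proof.
move=> sf; elim: N => [|[|N] IH]; try by
  exists 0%N, (fun=> 0); apply/funext => x; rewrite /lincomb !big_geq.
have := sine_spanD IH (sf N.+1); congr sine_span; apply/funext => x.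
by rewrite [RHS]big_nat_recr.
Qed.

(** Product to sum: 2 cos x sin (n x) = sin ((n + 1) x) + sin ((n - 1) x). *)
Lemma sine_span_cos f : sine_span f -> sine_span (fun x => cos x * f x).
Proof.
move=> [N [a ->]].
have -> : (fun x => cos x * lincomb sines N a x) =
    fun x => \sum_(1 <= n < N.+1) a n * 2^-1 * (sines n.+1 x + sines n.-1 x).
  apply/funext => x; rewrite /lincomb mulr_sumr; apply: eq_big_nat => -[//|n] _.
  rewrite /sines/= -(natr1 n.+1) (_ : n%:R = n.+1%:R - 1); last first.
    by rewrite -natr1 addrK.
  by rewrite mulrDl mulrBl mul1r sinD sinB; field.
apply: (@sine_span_sum (fun n x => a n * 2^-1 * (sines n.+1 x + sines n.-1 x))) => n.
by apply: sine_spanZ; apply: sine_spanD; exact: sine_span_sines.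
Qed.

(** With p = (1 - cos x) / 2 and 1 - p = (1 + cos x) / 2, each step of the recursion only multiplies
    by cos x and constants. *)
Lemma sine_span_bern n phi f : sine_span f ->
  sine_span (fun x => bern n ((1 - cos x) / 2) phi * f x).
Proof.
move=> sf; elim: n phi => [|n IH] phi /=; first exact: sine_spanZ.
have h1 := IH phi; have h2 := IH (fun k => phi k.+1).
have := sine_spanZ 2^-1 (sine_spanD (sine_spanD h1 (sine_span_cos h1))
  (sine_spanD h2 (sine_spanZ (-1) (sine_span_cos h2)))).
by congr sine_span; apply/funext => x /=; field.
Qed.

Lemma L2_0pi_sine_span f : sine_span f -> L2_0pi f.
Proof. by move=> [N [a ->]]; apply: L2_0pi_lincomb => n _; exact: L2_0pi_sines. Qed.

(** Points of [0, pi] at distance at least d thus have cosines at least 1 - cos d apart. The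
    difference of the two sides is 2 cos w (cos v - cos w) with w = y / 2 and v = y / 2 - x, where
    |v| <= w <= pi / 2. *)
Lemma cosB_ge (x y : R) : 0 <= x -> x <= y -> y <= pi ->
  1 - cos (y - x) <= cos x - cos y.
Proof.
move=> x0 xy ypi; rewrite -subr_ge0.
have -> : cos x - cos y - (1 - cos (y - x)) =
    2 * cos (y / 2) * (cos (y / 2 - x) - cos (y / 2)).
  have key (v w : R) : cos (w - v) - cos (w + w) - (1 - cos (w + v)) =
      2 * cos w * (cos v - cos w).
    by move: (cos2Dsin2 w); rewrite cosB !cosD => h; lra.
  by rewrite -key; congr (cos _ - cos _ - (1 - cos _)); field.
apply: mulr_ge0; first apply: mulr_ge0 => //.
  by apply: cos_ge0_pihalf; apply/andP; split; lra.
rewrite subr_ge0 -(cos_norm (_ - _)) leNgt ltr_cos -?leNgt; last 2 first.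
- by rewrite in_itv/=; apply/andP; split; lra.
- rewrite in_itv/= normr_ge0/= ler_norml; apply/andP; split; lra.
rewrite ler_norml; apply/andP; split; lra.
Qed.

End bernstein.

(** * Completeness of the sines *)

Section completeness.
Context {R : realType}.
Implicit Types (f g G : R -> R).
Let mu := @lebesgue_measure R.
Let I : set R := `]0, pi[.

Let mI : measurable I. Proof. exact: measurable_itv. Qed.

Lemma measurable_L2_0pi f : L2_0pi f -> measurable_fun I f.
Proof.
case/andP; rewrite inE/= => mf _.
exact: (measurable_restrictT f mI).2.
Qed.

Lemma nrm_lt f (e : R) : L2_0pi f -> 0 < e ->
  (\int[mu]_(x in I) (f x ^+ 2)%:E < (e ^+ 2)%:E)%E -> nrm f < e.
Proof.
move=> Lf e0; rewrite -nrm_sqr// lte_fin.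
by rewrite ltr_sqr ?nnegrE ?nrm_ge0// ltW.
Qed.

Lemma nrm_dominated f (f_ : nat -> R -> R) G : L2_0pi f ->
  (forall n, L2_0pi (f_ n)) -> mu.-integrable I (EFin \o G) ->
  (forall n x, I x -> (f x - f_ n x) ^+ 2 <= G x) ->
  (forall x, I x -> f_ ^~ x @ \oo --> f x) ->
  forall e, 0 < e -> exists n, nrm (f \- f_ n) < e.
Proof.
move=> Lf Lf_ iG fG cvgf e e0.
pose F n x : \bar R := ((f x - f_ n x) ^+ 2)%:E.
have mF n : measurable_fun I (F n).
  apply/measurable_EFinP/measurable_funX.
  by apply: measurable_funB; exact: measurable_L2_0pi.
have ae1 : {ae mu, forall x, I x -> F ^~ x @ \oo --> cst 0%E x}.
  apply/aeW => x Ix; apply/cvg_EFin; first exact: nearW.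
  have : (f x - f_ n x) ^+ 2 @[n --> \oo] --> (f x - f x) ^+ 2.
    apply: (@cvg_comp _ _ _ (fun n => f x - f_ n x) (fun y => y ^+ 2) _ (nbhs (f x - f x))).
      by apply: cvgB; [exact: cvg_cst|exact: cvgf].
    exact: exprn_continuous.
  by rewrite subrr expr0n.
have ae2 : {ae mu, forall x n, I x -> (`|F n x| <= (EFin \o G) x)%E}.
  by apply/aeW => x n Ix; rewrite /F gee0_abs ?lee_fin ?sqr_ge0// fG.
have [_ _] := @dominated_convergence _ _ _ mu I mI F (cst 0%E) (EFin \o G)
  mF (measurable_cst _) ae1 iG ae2.
(* Convergence in the extended reals is split into eventual finiteness and convergence of the real
   values; the index below is past both thresholds. *)
rewrite integral0 => /fine_cvgP[fin] /cvgrPdist_lt/(_ (e ^+ 2)).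
rewrite exprn_gt0// => /(_ isT)[N1 _ hN1]; case: fin => N2 _ hN2.
exists (maxn N1 N2); apply: nrm_lt => //; first exact: L2_0piB.
have /= h1 := hN1 (maxn N1 N2) (leq_maxl _ _).
have /= /fineK h2 := hN2 (maxn N1 N2) (leq_maxr _ _).
apply: (@le_lt_trans _ _ (fine (\int[mu]_(x in I) F (maxn N1 N2) x))%:E).
  by rewrite h2.
move: h1; rewrite sub0r normrN lte_fin; apply: le_lt_trans.
exact: ler_norm.
Qed.

(** The nodes are the angles whose (1 - cos) / 2 is k / (n + 1). The statement is pointwise because
    the function it serves, a quotient by sin, is controlled at the endpoints only by a bound. *)
Lemma bern_cvg g (M x : R) : 0 <= x <= pi ->
  (forall y, 0 <= y <= pi -> `|g y| <= M) -> {for x, continuous g} ->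
  bern n.+1 ((1 - cos x) / 2) (fun k => g (acos (1 - 2 * k%:R / n.+1%:R)))
    @[n --> \oo] --> g x.
Proof.
move=> x0pi gM cg; apply/cvgrPdist_le => e e0.
have e2 : 0 < e / 2 by rewrite divr_gt0.
have M0 : 0 <= M by exact: le_trans (gM _ x0pi).
have /cvgrPdist_le/(_ _ e2)/nbhs_ballP[d0 /= d00 hd0] := cg.
(* The cap at pi keeps [d] where cos is decreasing, so that [c] below is positive. *)
pose d := Num.min d0 pi.
have d_gt0 : 0 < d by rewrite lt_min d00 pi_gt0.
have dpi : d <= pi by rewrite ge_min lexx orbT.
pose c := 1 - cos d.
have c0 : 0 < c.
  rewrite subr_gt0 -(@cos0 R) ltr_cos ?in_itv/= ?lexx ?pi_ge0 ?dpi ?(ltW d_gt0)//.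
(* Within distance [d] of x continuity suffices; beyond it the cosines differ by at least [c], so
   the quadratic barrier exceeds 2 M, the trivial bound. *)
pose K := 2 * M / c ^+ 2.
have K0 : 0 <= K by rewrite divr_ge0 ?mulr_ge0 ?exprn_ge0// ltW.
have hg y : 0 <= y <= pi -> `|g y - g x| <= e / 2 + K * (cos x - cos y) ^+ 2.
  move=> y0pi; have [dxy|dxy] := ltP `|x - y| d.
    rewrite (@le_trans _ _ (e / 2))//; last by rewrite lerDl mulr_ge0// sqr_ge0.
    by rewrite distrC; apply: hd0; rewrite /ball/= (lt_le_trans dxy)// ge_min lexx.
  rewrite (@le_trans _ _ (2 * M))//.
    by rewrite (le_trans (ler_normB _ _))// mulr2n mulrDl mul1r lerD// gM.
  rewrite (@le_trans _ _ (K * (cos x - cos y) ^+ 2))//; last by rewrite lerDr ltW.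
  rewrite /K mulrAC ler_pdivlMr ?exprn_gt0//; apply: ler_wpM2l; first by rewrite mulr_ge0.
  rewrite -[leRHS]real_normK ?num_real// ler_sqr ?nnegrE ?(ltW c0)//.
  move: x0pi y0pi => /andP[x0 xpi] /andP[y0 ypi].
  have cd z : d <= z -> z <= pi -> c <= 1 - cos z.
    move=> dz zpi; rewrite lerD2l lerN2 leNgt ltr_cos -?leNgt//;
      by rewrite in_itv/= ?(ltW d_gt0) ?dpi ?zpi ?(le_trans (ltW d_gt0) dz).
  have [xy|yx] := leP x y.
    rewrite (le_trans _ (ler_norm _))// (le_trans _ (cosB_ge x0 xy ypi))//.
    apply: cd; last by lra.
    by move: dxy; rewrite distrC ger0_norm ?subr_ge0.
  rewrite distrC (le_trans _ (ler_norm _))// (le_trans _ (cosB_ge y0 (ltW yx) xpi))//.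
  apply: cd; last by lra.
  by move: dxy; rewrite ger0_norm ?subr_ge0 ?(ltW yx).
pose p := (1 - cos x) / 2.
have p01 : 0 <= p <= 1.
  by have := cos_le1 x; have := cos_geN1 x; rewrite /p => ? ?; apply/andP; split; lra.
have : 4 * K / n.+1%:R @[n --> \oo] --> 4 * K * 0.
  by apply: cvgM; [exact: cvg_cst|exact: cvg_harmonic].
rewrite mulr0 => /cvgrPdist_le/(_ _ e2)[N _ hN]; exists N => // n Nn.
have := hN n Nn; rewrite sub0r normrN ger0_norm; last by rewrite divr_ge0// mulr_ge0.
move=> hn; rewrite distrC.
have n0 : 0 < n.+1%:R :> R by rewrite ltr0n.
(* At the k-th node cos x - cos y = 2 (k - (n + 1) p) / (n + 1), whence the constant 4 K / (n +
   1)^2. The centre (n + 1) p is the binomial mean, so only the variance remains. *)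
have := @bern_approx _ n.+1 p (fun k => g (acos (1 - 2 * k%:R / n.+1%:R))) (g x) (e / 2)
  (4 * K / n.+1%:R ^+ 2) (n.+1%:R * p) p01.
move=> /(_ _)/le_trans; apply.
  move=> k kn; have kn' : k%:R / n.+1%:R <= 1 :> R by rewrite ler_pdivrMr// mul1r ler_nat.
  have k0 : 0 <= k%:R / n.+1%:R :> R by rewrite divr_ge0.
  have a1 : -1 <= (1 : R) - 2 * k%:R / n.+1%:R <= 1.
    by rewrite -mulrA; move: (_ / _) k0 kn' => t t0 t1; apply/andP; split; lra.
  have := hg (acos (1 - 2 * k%:R / n.+1%:R)).
  rewrite acos_ge0// acos_lepi// => /(_ isT)/le_trans; apply.
  rewrite acosK ?in_itv//= lerD2l le_eqVlt; apply/orP; left; apply/eqP.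
  by rewrite /p; field.
rewrite [leRHS](_ : e = e / 2 + e / 2); last by field.
rewrite lerD2l subrr expr0n/= add0r; apply: le_trans hn.
have -> : 4 * K / n.+1%:R ^+ 2 * (n.+1%:R * (p * (1 - p))) =
    4 * K / n.+1%:R * (p * (1 - p)) by field.
case/andP: p01 => p0 p1.
apply: ler_piMr; first by apply: divr_ge0 => //; exact: mulr_ge0.
by rewrite mulr_ile1 ?subr_ge0// lerBlDr lerDl.
Qed.

(** Truncation to the band between - k sin and k sin, which makes the quotient by sin bounded. *)
Let clip (k : R) g x := Num.max (- (k * sin x)) (Num.min (k * sin x) (g x)).

Let clip_le k g x : 0 <= k * sin x -> `|clip k g x| <= k * sin x.
Proof.
move=> h; rewrite /clip ler_norml; apply/andP; split.
  by rewrite le_max lexx.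
by rewrite ge_max ge_min lexx/= andbT; lra.
Qed.

(** Clipping projects onto an interval containing y, so it does not increase the distance to y. *)
Let clip_dist k g x y : `|y| <= k * sin x -> `|y - clip k g x| <= `|y - g x|.
Proof.
rewrite ler_norml => /andP[h1 h2]; rewrite /clip.
have [h3|h3] := leP (k * sin x) (g x).
  have [h4|h4] := leP (- (k * sin x)) (k * sin x); last by lra.
  by rewrite !ler0_norm; lra.
have [h4|h4] := leP (- (k * sin x)) (g x) => //.
by rewrite !ger0_norm; lra.
Qed.

Let continuous_clip k g : continuous g -> continuous (clip k g).
Proof.
move=> cg x.
have cs : {for x, continuous (fun x => k * sin x)}.
  by apply: continuousM; [exact: cvg_cst|exact: continuous_sin].
apply: (@continuous_max _ _ (fun x => - (k * sin x)) (fun x => Num.min (k * sin x) (g x))).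
  exact: continuousN.
by apply: (@continuous_min _ _ (fun x => k * sin x)) => //; exact: cg.
Qed.

Lemma clip_sine_span k g e : 0 <= k -> continuous g -> 0 < e ->
  exists2 S, sine_span S & nrm (clip k g \- S) < e.
Proof.
move=> k0 cg e0; pose h y := clip k g y / sin y.
pose S n x := bern n.+1 ((1 - cos x) / 2) (fun i => h (acos (1 - 2 * i%:R / n.+1%:R))) * sines 1 x.
have sS n : sine_span (S n) by apply: sine_span_bern; exact: sine_span_sines.
have ks x : 0 <= x <= pi -> 0 <= k * sin x by move=> x0; rewrite mulr_ge0// sin_ge0_pi.
(* Where sin vanishes, division by 0 makes [h] equal to 0, so the bound also covers the nodes 0 and
   pi. *)
have hk y : 0 <= y <= pi -> `|h y| <= k.
  move=> y0; have := sin_ge0_pi y0; rewrite le_eqVlt => /predU1P[s0|s0].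
    by rewrite /h -s0 invr0 mulr0 normr0.
  rewrite /h normrM normfV (gtr0_norm s0) ler_pdivrMr//.
  exact/clip_le/ks.
have I0 x : I x -> 0 <= x <= pi by rewrite /I/= in_itv/= => /andP[/ltW-> /ltW->].
have Is x : I x -> 0 < sin x by rewrite /I/= in_itv/=; exact: sin_gt0_pi.
have [] := @nrm_dominated (clip k g) S (fun=> (2 * k) ^+ 2) _ _ _ _ _ e e0.
- apply: (@L2_0pi_measurable_bounded _ _ k).
    by apply: measurable_funTS; apply: continuous_measurable_fun; exact: continuous_clip.
  move=> x Ix; rewrite (le_trans (clip_le _ (ks _ (I0 _ Ix))))//.
  by rewrite ler_piMr// sin_le1.
- by move=> n; exact: L2_0pi_sine_span.
- apply/integrableP; split; first exact: measurable_cst.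
  rewrite integral_cst//= lebesgue_measure_itv/= lte_fin pi_gt0 -EFinB -EFinM.
  by rewrite ltry.
- move=> n x Ix; rewrite -[leLHS]real_normK ?num_real// ler_sqr ?nnegrE ?mulr_ge0//.
  rewrite (le_trans (ler_normB _ _))// mulr2n mulrDl mul1r lerD//.
    by rewrite (le_trans (clip_le _ (ks _ (I0 _ Ix))))// ler_piMr// sin_le1.
  rewrite /S normrM; apply: (@le_trans _ _ (k * 1)); last by rewrite mulr1.
  apply: ler_pM => //; last exact: sin_max.
  apply: bern_bounded.
    by have := cos_le1 x; have := cos_geN1 x => ? ?; apply/andP; split; lra.
  move=> i ik; have ik' : i%:R / n.+1%:R <= 1 :> R by rewrite ler_pdivrMr// mul1r ler_nat.
  have i0 : 0 <= i%:R / n.+1%:R :> R by rewrite divr_ge0.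
  have a1 : -1 <= (1 : R) - 2 * i%:R / n.+1%:R <= 1.
    by rewrite -mulrA; move: (_ / _) i0 ik' => t t0 t1; apply/andP; split; lra.
  by apply: hk; rewrite acos_ge0// acos_lepi.
- move=> x Ix; rewrite (_ : clip k g x = h x * sines 1 x); last first.
    by rewrite /h /sines mul1r divfK// gt_eqF// Is.
  apply: cvgM; last exact: cvg_cst.
  apply: (bern_cvg (M := k)) => //; first exact: I0.
  apply: continuousM; first exact: continuous_clip.
  by apply: continuousV; [rewrite gt_eqF// Is|exact: continuous_sin].
by move=> n hn; exists (S n).
Qed.

Theorem complete_sines : complete_system (@sines R).
Proof.
move=> f Lf e e0.
have e3 : 0 < e / 3 by rewrite divr_gt0.
have Is x : I x -> 0 < sin x by rewrite /I/= in_itv/=; exact: sin_gt0_pi.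
have mf := measurable_L2_0pi Lf.
(* Cutting at height n sin x rather than n makes [f_ n] fit the band of [clip]. *)
pose f_ (n : nat) x := if `|f x| <= n%:R * sin x then f x else 0.
have mf_ n : measurable_fun I (f_ n).
  apply: measurable_fun_if => //.
  - apply: measurable_fun_ler; first exact: measurableT_comp.
    apply: measurable_funTS; apply: measurable_funM => //.
    by apply: continuous_measurable_fun; exact: continuous_sin.
  - by apply: measurable_funS mf => // x [].
have f_le n x : I x -> `|f_ n x| <= n%:R * sin x.
  move=> Ix; rewrite /f_; case: ifPn => // _.
  by rewrite normr0 mulr_ge0// ltW// Is.
have f_le1 n x : I x -> `|f_ n x| <= n%:R.
  by move=> Ix; rewrite (le_trans (f_le _ _ Ix))// ler_piMr// sin_le1.
have Lf_ n : L2_0pi (f_ n) by exact: L2_0pi_measurable_bounded (mf_ n) (f_le1 n).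
have [] := @nrm_dominated f f_ (fun x => f x ^+ 2) Lf Lf_ (L2_0pi_integrable_sqr Lf) _ _ _ e3.
- move=> n x Ix; rewrite /f_; case: ifPn => _; last by rewrite subr0.
  by rewrite subrr expr0n sqr_ge0.
(* As sin x > 0, the cut is inactive at x once n >= |f x| / sin x. *)
- move=> x Ix; apply: cvg_near_cst.
  exists (Num.truncn (`|f x| / sin x)).+1 => // n /= hn.
  rewrite /f_ -ler_pdivrMr ?Is//.
  rewrite ifT// (le_trans (ltW (truncnS_gt _)))// ler_nat//.
move=> n hn.
have mu_fin : (mu I < +oo)%E.
  by rewrite /mu lebesgue_measure_itv/= lte_fin pi_gt0 -EFinB ltry.
have if_ : mu.-integrable I (EFin \o f_ n).
  apply: (@measurable_bounded_integrable _ _ _ mu (f_ n) I mI mu_fin (mf_ n)).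
  exists n%:R; split; first exact: num_real.
  by move=> M nM x Ix; exact: (le_trans (f_le1 n x Ix) (ltW nM)).
have [g_ [cg_ ig_ cvg_g]] := approximation_continuous_integrable mI mu_fin if_.
(* The continuous approximation is in L^1. Since [f_ n] and the clipped function are bounded by n,
   their squared difference is at most 2 (n + 1) |f_n - g|, so this L^1 error yields an L^2 error e
   / 3. Taking n + 1 avoids a zero divisor at n = 0. *)
pose eta := (e / 3) ^+ 2 / (2 * n.+1%:R).
have n1 : 0 < 2 * n.+1%:R :> R by rewrite mulr_gt0// ltr0n.
have eta0 : 0 < eta by rewrite divr_gt0// exprn_gt0.
move/fine_cvgP : cvg_g => [[N1 _ hN1] /cvgrPdist_lt/(_ _ eta0)[N2 _ hN2]].
have /= /fineK h1 := hN1 (maxn N1 N2) (leq_maxl _ _).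
have /= h2 := hN2 (maxn N1 N2) (leq_maxr _ _).
move: h1 h2 (cg_ (maxn N1 N2)) (ig_ (maxn N1 N2)).
move: (g_ _) => g h1 h2 cg ig.
have {h1 h2} hg : (\int[mu]_(x in I) `|f_ n x - g x|%:E < eta%:E)%E.
  rewrite -h1 lte_fin; apply: le_lt_trans h2.
  by rewrite sub0r normrN ler_norm.
have ks x : I x -> 0 <= n%:R * sin x by move=> /Is/ltW s0; rewrite mulr_ge0.
have mclip : measurable_fun I (clip n%:R g).
  by apply: measurable_funTS; apply: continuous_measurable_fun; exact: continuous_clip.
have clip1 x : I x -> `|clip n%:R g x| <= n%:R.
  by move=> Ix; rewrite (le_trans (clip_le _ (ks _ Ix)))// ler_piMr// sin_le1.
have Lclip : L2_0pi (clip n%:R g) by exact: L2_0pi_measurable_bounded mclip clip1.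
have mfg : measurable_fun I (fun x => `|f_ n x - g x|%:E).
  apply/measurable_EFinP/measurableT_comp => //; apply: measurable_funB => //.
  by apply: measurable_funTS; exact: continuous_measurable_fun.
have hclip : nrm (f_ n \- clip n%:R g) < e / 3.
  apply: nrm_lt => //; first exact: L2_0piB.
  apply: (@le_lt_trans _ _ (\int[mu]_(x in I) ((2 * n.+1%:R)%:E * `|f_ n x - g x|%:E))%E).
    apply: ge0_le_integral => //.
    - by move=> x _; rewrite lee_fin sqr_ge0.
    - by apply/measurable_EFinP; apply: measurable_funX; exact: measurable_L2_0pi (L2_0piB (Lf_ n) Lclip).
    - exact: measurable_funeM.
    move=> x Ix; rewrite -EFinM lee_fin -real_normK ?num_real// expr2.
    apply: ler_pM => //; last exact/clip_dist/f_le.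
    rewrite (le_trans (ler_normB _ _))//.
    rewrite (le_trans (lerD (f_le1 n x Ix) (clip1 x Ix)))//.
    by rewrite -natr1; have := ler0n R n; lra.
  rewrite ge0_integralZl_EFin ?(ltW n1)//.
  have -> : (e / 3) ^+ 2 = 2 * n.+1%:R * eta by rewrite /eta [RHS]mulrC divfK// gt_eqF.
  by rewrite [(_ * eta)%:E]EFinM lte_pmul2l // lte_fin.
have [S sS hS] := clip_sine_span (ler0n R n) cg e3.
have [N [a Sa]] := sS; exists N, a; rewrite -Sa L2norm_0piE; last first.
  by apply: L2_0piB => //; exact: L2_0pi_sine_span.
rewrite lte_fin.
have LS := L2_0pi_sine_span sS.
have L1 := L2_0piB Lf (Lf_ n); have L2 := L2_0piB (Lf_ n) Lclip.
have L3 := L2_0piB Lclip LS.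
have -> : (fun x => f x - S x) =
    (f \- f_ n) \+ ((f_ n \- clip n%:R g) \+ (clip n%:R g \- S)).
  by apply/funext => x /=; ring.
apply: (le_lt_trans (ler_nrmD L1 (L2_0piD L2 L3))).
have := ler_nrmD L2 L3; lra.
Qed.

End completeness.

(** * Solutions of the initial value problem *)

Section gronwall.
Context {R : realType}.
Implicit Types (a b p q x y : R) (u v w z : R -> R).

Lemma within_continuousM (A : set R) u w : {within A, continuous u} ->
  {within A, continuous w} -> {within A, continuous (u \* w)}.
Proof.
by move=> cu cw x; apply: (@continuousM _ (subspace A) u w x); [exact: cu|exact: cw].
Qed.

Let rhs a b x := a * Num.max x 0 - b * Num.max (- x) 0.

Let rhs_lipschitz a b x y : 0 <= a -> 0 <= b ->
  `|rhs a b x - rhs a b y| <= (a + b) * `|x - y|.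
Proof.
move=> a0 b0; rewrite /rhs.
wlog xy : x y / x <= y.
  move=> h; have [xy|/ltW yx] := leP x y; first exact: h.
  by rewrite distrC (distrC x) h.
rewrite (distrC x) (ger0_norm (_ : 0 <= y - x)) ?subr_ge0//.
rewrite ler_norml.
have [x0|x0] := leP x 0; have [y0|y0] := leP y 0;
  have [x1|x1] := leP (- x) 0; have [y1|y1] := leP (- y) 0; apply/andP; split; nra.
Qed.

Lemma within_continuous_bounded p q u : p <= q -> {within `[p, q], continuous u} ->
  exists2 M, 0 <= M & forall x, x \in `[p, q] -> `|u x| <= M.
Proof.
move=> pq cu; have [c1 _ h1] := EVT_max pq cu; have [c2 _ h2] := EVT_min pq cu.
exists (`|u c1| + `|u c2|); first exact: addr_ge0.
move=> x xI; have {}h1 := h1 x xI; have {}h2 := h2 x xI.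
have := ler_norm (u c1); have := ler_norm (- u c2); rewrite normrN => h3 h4.
have h5 := normr_ge0 (u c1); have h6 := normr_ge0 (u c2).
by rewrite ler_norml; apply/andP; split; lra.
Qed.

(** The equation is written as a first order system with derivatives in the open interval and
    continuity on the closed one, so that it can start at 0, where only a right derivative is
    given. *)
Lemma fucik_uniqueness a b p q u v w z : 0 <= a -> 0 <= b -> p <= q ->
  {within `[p, q], continuous u} -> {within `[p, q], continuous v} ->
  {within `[p, q], continuous w} -> {within `[p, q], continuous z} ->
  {in `]p, q[, forall x, is_derive x 1 u (v x)} ->
  {in `]p, q[, forall x, is_derive x 1 v (- (a * u^\+ x - b * u^\- x))} ->
  {in `]p, q[, forall x, is_derive x 1 w (z x)} ->
  {in `]p, q[, forall x, is_derive x 1 z (- (a * w^\+ x - b * w^\- x))} ->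
  u p = w p -> v p = z p -> u q = w q /\ v q = z q.
Proof.
move=> a0 b0 pq cu cv cw cz du dv dw dz up vp.
(* In the derivative of the squared distance, 1 bounds the contribution of u' - w' and a + b, the
   Lipschitz constant of the right-hand side, that of v' - z'. *)
pose K := 1 + (a + b).
pose G := (fun x => expR (- K * x + 0)) \*
  (((u \- w) \* (u \- w)) \+ ((v \- z) \* (v \- z))).
have dexp (x : R) : is_derive x 1 (fun x => expR (- K * x + 0)) (expR (- K * x + 0) * - K).
  apply: (@is_derive1_comp _ expR (fun y => - K * y + 0)); exact: is_derive_affine.
(* Gronwall: G is nonincreasing, since K bounds the growth rate of the squared
   distance, and G p = 0. *)
have cG : {within `[p, q], continuous G}.
  apply: within_continuousM.
    by apply: continuous_subspaceT; exact: is_derive_continuous dexp.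
  by apply: within_continuousD; apply: within_continuousM; exact: within_continuousB.
have dG x : x \in `]p, q[ -> derivable G x 1 /\ (G^`())%classic x <= 0.
  move=> xpq.
  have [] := is_deriveM (dexp x) (is_deriveD
    (is_deriveM (is_deriveB (du x xpq) (dw x xpq)) (is_deriveB (du x xpq) (dw x xpq)))
    (is_deriveM (is_deriveB (dv x xpq) (dz x xpq)) (is_deriveB (dv x xpq) (dz x xpq)))).
  rewrite -/G => dG1 dG2; split; first exact: dG1.
  rewrite derive1E dG2 /GRing.scale/= !fctE.
  have E0 := expR_gt0 (- K * x + 0).
  have := rhs_lipschitz (u x) (w x) a0 b0; rewrite /rhs.
  rewrite -/(u^\+ x) -/(u^\- x) -/(w^\+ x) -/(w^\- x).
  move: (expR _) E0 => E E0.
  set gu := a * u^\+ x - _; set gw := a * w^\+ x - _.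
  move: (u x) (v x) (w x) (z x) => U V W Z hl.
  have {}hl : 2 * (V - Z) * (gw - gu) <= (a + b) * ((U - W) ^+ 2 + (V - Z) ^+ 2).
    have h1 : (V - Z) * (gw - gu) <= `|V - Z| * ((a + b) * `|U - W|).
      rewrite (le_trans (ler_norm _))// normrM ler_wpM2l//.
      by rewrite distrC.
    have h2 : 2 * `|V - Z| * `|U - W| <= (U - W) ^+ 2 + (V - Z) ^+ 2.
      rewrite -[(U - W) ^+ 2]real_normK ?num_real// -[(V - Z) ^+ 2]real_normK ?num_real//.
      by have := sqr_ge0 (`|U - W| - `|V - Z|); rewrite sqrrB; lra.
    have := ler_wpM2l (addr_ge0 a0 b0) h2; lra.
  have h3 : 2 * (U - W) * (V - Z) <= (U - W) ^+ 2 + (V - Z) ^+ 2.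
    by have := sqr_ge0 ((U - W) - (V - Z)); lra.
  have : 2 * (U - W) * (V - Z) + 2 * (V - Z) * (gw - gu)
      - K * ((U - W) ^+ 2 + (V - Z) ^+ 2) <= 0 by rewrite /K; lra.
  move=> /(ler_wpM2l (ltW E0)); rewrite mulr0; apply: le_trans.
  by rewrite le_eqVlt; apply/orP; left; apply/eqP; ring.
have := @ler0_derive1_nincr _ G p q (fun x h => (dG x h).1) (fun x h => (dG x h).2) cG p q
  (lexx p) pq (lexx q).
rewrite /G/= ?fctE up vp !subrr !mul0r !addr0 mulr0 pmulr_rle0 ?expR_gt0// -!expr2.
move=> h; have h1 := sqr_ge0 (u q - w q); have h2 := sqr_ge0 (v q - z q).
by split; apply/eqP; rewrite -subr_eq0 -sqrf_eq0 eq_le; apply/andP; split; lra.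
Qed.

End gronwall.

(** * Explicit form of a solution on its bumps *)

Section fucik_explicit.
Context {R : realType}.
Variables (a b d : R) (u : R -> R).
Hypotheses (a0 : 0 < a) (b0 : 0 < b) (d0 : 0 < d)
  (sol : fucik_solution a b u) (rd : right_derivative_at0 u d).

(* The derivative of u, continuously extended to 0. *)
Let v x := if x == 0 then d else (u^`())%classic x.

Let du : {in `]0, pi[, forall x : R, is_derive x 1 u (v x)}.
Proof.
case: sol => -[_ C2] _ _ _ x x0.
have [du _ _] := C2 x x0; rewrite /v gt_eqF; last by case/andP: x0.
by rewrite derive1E; exact: DeriveDef.
Qed.

Let dv : {in `]0, pi[, forall x : R, is_derive x 1 v (- (a * u^\+ x - b * u^\- x))}.
Proof.
case: sol => -[_ C2] ode _ _ x xI.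
have [_ ddu _] := C2 x xI; rewrite -ode// opprK.
have x0 : 0 < x by case/andP: xI.
apply: (@near_eq_is_derive _ _ _ (u^`())%classic).
  near=> y; rewrite /v gt_eqF//; near: y; exact: lt_nbhsr.
by rewrite /= derive1E; exact: DeriveDef.
Unshelve. all: by end_near. Qed.

Let cu : {within `[0, pi], continuous u}. Proof. by case: sol => -[]. Qed.

Let sub_oo (p q x : R) : 0 <= p -> q <= pi -> x \in `]p, q[ -> x \in `]0, pi[.
Proof.
move=> p0 qpi; rewrite !in_itv/= => /andP[px xq].
by rewrite (le_lt_trans p0 px) (lt_le_trans xq qpi).
Qed.

Let u_itv p q : 0 <= p -> q <= pi -> {within `[p, q], continuous u}.
Proof.
move=> p0 qpi; apply: continuous_subspaceW cu => x /=.
by rewrite !in_itv/= => /andP[px xq]; rewrite (le_trans p0 px) (le_trans xq qpi).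
Qed.

Let ddu_bounded : exists2 B, 0 <= B &
  forall x, 0 <= x <= pi -> `|- (a * u^\+ x - b * u^\- x)| <= B.
Proof.
have [M M0 hM] := within_continuous_bounded (pi_ge0 R) cu.
exists ((a + b) * M); first by rewrite mulr_ge0 ?addr_ge0// ltW.
move=> x xI.
apply: (@le_trans _ _ ((a + b) * `|u x|)); last first.
  by rewrite ler_wpM2l ?hM// addr_ge0// ltW.
rewrite normrN /funrpos /funrneg ler_norml.
have := ltW a0; have := ltW b0 => b1 a1.
have [x0|x0] := leP (u x) 0; [rewrite ler0_norm//|rewrite gtr0_norm//];
  have [x1|x1] := leP (- u x) 0; apply/andP; split; nra.
Qed.

(** Two mean value theorems: the difference quotient at 0 is v c for some c in (0, x), and |v x - v
    c| <= B x because the second derivative is bounded by the equation. *)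
Let v_cvg0 : v x @[x --> 0^'+] --> d.
Proof.
have [B B0 hB] := ddu_bounded.
have key x : 0 < x -> x < pi -> `|v x - (u x - u 0) / x| <= B * x.
  move=> x0 xpi.
  have [|c cI ->] := @MVT _ u v 0 x x0 _ (u_itv (lexx 0) (ltW xpi)).
    by move=> y yI; apply: du; exact: sub_oo (lexx 0) (ltW xpi) yI.
  rewrite subr0 mulfK ?gt_eqF//.
  move: cI; rewrite in_itv/= => /andP[c0 cx].
  have [||e eI ->] := @MVT_segment _ v (fun x => - (a * u^\+ x - b * u^\- x)) c x (ltW cx).
  - by move=> y yI; apply: dv; exact: sub_oo (ltW c0) (ltW xpi) yI.
  - apply: derivable_within_continuous => y; rewrite in_itv/= => /andP[cy yx].
    have [] := dv (_ : y \in `]0, pi[) => //.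
    by rewrite in_itv/= (lt_le_trans c0 cy) (le_lt_trans yx xpi).
  move: eI; rewrite in_itv/= => /andP[ce ex].
  rewrite normrM (ger0_norm (_ : 0 <= x - c)) ?subr_ge0 ?(ltW cx)//.
  apply: ler_pM => //; first by rewrite subr_ge0 ltW.
    by apply: hB; rewrite (le_trans (ltW c0) ce) (le_trans ex (ltW xpi)).
  by rewrite lerBlDr lerDl ltW.
apply/cvgrPdist_le => e e0; have e2 : 0 < e / 2 by rewrite divr_gt0.
have /cvgrPdist_le/(_ _ e2) rd2 := rd.
have B1 : 0 < e / 2 / (B + 1) by rewrite divr_gt0// ltr_pwDr.
near=> x.
have x0 : 0 < x by near: x; exact: nbhs_right_gt.
have xpi : x < pi by near: x; apply: nbhs_right_lt; exact: pi_gt0.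
have h1 : `|d - (u x - u 0) / x| <= e / 2 by near: x.
have h2 : x <= e / 2 / (B + 1).
  by apply/ltW; near: x; apply: nbhs_right_lt.
have h3 : B * x <= e / 2.
  move: h2; rewrite ler_pdivlMr ?ltr_pwDr//; nra.
have -> : d - v x = (d - (u x - u 0) / x) - (v x - (u x - u 0) / x) by ring.
rewrite (le_trans (ler_normB _ _))// [leRHS](_ : e = e / 2 + e / 2); last by field.
by apply: lerD => //; exact: le_trans (key x x0 xpi) h3.
Unshelve. all: by end_near. Qed.

(** The inequality q < pi is strict because no derivative is given at pi; there the boundary
    condition supplies the value of [u]. *)
Let v_itv p q : 0 <= p -> q < pi -> {within `[p, q], continuous v}.
Proof.
move=> p0 qpi.
have [q0|q0] := leP q 0.
  have [qp|pq] := ltP q p; first by rewrite set_itv_ge -?leNgt ?bnd_simp//; exact: continuous_subspace0.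
  have -> : q = p by apply/eqP; rewrite eq_le pq (le_trans q0 p0).
  by rewrite set_itv1; exact: continuous_subspace1.
have cv x : 0 < x -> x < pi -> {for x, continuous v}.
  move=> x0 xpi; apply/differentiable_continuous/derivable1_diffP.
  by have [] := dv (_ : x \in `]0, pi[); rewrite ?in_itv/= ?x0.
apply: (@continuous_subspaceW _ _ _ `[0, q]).
  by move=> x /=; rewrite !in_itv/= => /andP[px ->]; rewrite (le_trans p0 px).
apply/continuous_within_itvP => //; split.
- move=> x; rewrite in_itv/= => /andP[x0 xq]; apply: cv => //; exact: lt_trans qpi.
- by rewrite {2}/v eqxx.
- by apply/cvg_at_left_filter; exact: cv.
Qed.

(** While a sinusoid keeps its sign, the equation is linear along it, with c = a or c = b;
    uniqueness then identifies it with [u]. *)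
Let bump c s p t : 0 < c -> 0 <= p -> p <= t -> t < pi ->
  let w x := s / Num.sqrt c * sin (Num.sqrt c * x + - (Num.sqrt c * p)) in
  {in `]p, t[, forall x, a * Num.max (w x) 0 - b * Num.max (- w x) 0 = c * w x} ->
  u p = 0 -> v p = s ->
  u t = s / Num.sqrt c * sin (Num.sqrt c * (t - p)) /\
  v t = s * cos (Num.sqrt c * (t - p)).
Proof.
move=> c0 p0 pt tpi w hw up vp.
have sc : 0 < Num.sqrt c by rewrite sqrtr_gt0.
pose z x := s * cos (Num.sqrt c * x + - (Num.sqrt c * p)).
have dw (x : R) : is_derive x 1 w (z x).
  apply: eq_is_derive (is_deriveMl (s / Num.sqrt c)
    (is_derive_sin_affine (Num.sqrt c) (- (Num.sqrt c * p)) x)) _ _ => //.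
  by rewrite /z; field; rewrite gt_eqF.
have dz (x : R) : is_derive x 1 z (- (c * w x)).
  apply: eq_is_derive (is_deriveMl s
    (is_derive_cos_affine (Num.sqrt c) (- (Num.sqrt c * p)) x)) _ _ => //.
  rewrite /w; have := sqr_sqrtr (ltW c0); set r := Num.sqrt c in sc *.
  by move=> E; rewrite -[in RHS]E; field; rewrite gt_eqF.
rewrite mulrBr.
apply: (@fucik_uniqueness _ a b p t u v w z (ltW a0) (ltW b0) pt).
- by apply: u_itv => //; exact: ltW.
- exact: v_itv.
- by apply: continuous_subspaceT; exact: is_derive_continuous dw.
- by apply: continuous_subspaceT; exact: is_derive_continuous dz.
- by move=> x xI; apply: du; exact: sub_oo p0 (ltW tpi) xI.
- by move=> x xI; apply: dv; exact: sub_oo p0 (ltW tpi) xI.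
- by move=> x _.
- by move=> x xI; rewrite /funrpos /funrneg hw.
- by rewrite up /w subrr sin0 mulr0.
- by rewrite vp /z subrr cos0 mulr1.
Qed.

Let l1 := pi / Num.sqrt a.
Let l2 := pi / Num.sqrt b.
Let sa : 0 < Num.sqrt a. Proof. by rewrite sqrtr_gt0. Qed.
Let sb : 0 < Num.sqrt b. Proof. by rewrite sqrtr_gt0. Qed.
Let l1_gt0 : 0 < l1. Proof. by rewrite divr_gt0 ?pi_gt0. Qed.
Let l2_gt0 : 0 < l2. Proof. by rewrite divr_gt0 ?pi_gt0. Qed.

Let sin_bump_ge0 (k p x : R) : 0 < k -> p <= x -> x <= p + pi / k -> 0 <= sin (k * x + - (k * p)).
Proof.
move=> k0 px xp; rewrite -mulrBr sin_ge0_pi// mulr_ge0 ?(ltW k0) ?subr_ge0//=.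
by rewrite mulrC -ler_pdivlMr// lerBlDl.
Qed.

Let pos_bump p t : 0 <= p -> p <= t -> t <= p + l1 -> t < pi ->
  u p = 0 -> v p = d ->
  u t = d / Num.sqrt a * sin (Num.sqrt a * (t - p)) /\
  v t = d * cos (Num.sqrt a * (t - p)).
Proof.
move=> p0 pt tp tpi up vp; apply: bump => // x; rewrite in_itv/= => /andP[px xt].
have h : 0 <= d / Num.sqrt a * sin (Num.sqrt a * x + - (Num.sqrt a * p)).
  rewrite mulr_ge0 ?divr_ge0 ?(ltW d0) ?(ltW sa)// sin_bump_ge0 ?(ltW px)//.
  exact: le_trans (ltW xt) tp.
by rewrite max_l// max_r ?oppr_le0// mulr0 subr0.
Qed.

Let neg_bump p t : 0 <= p -> p <= t -> t <= p + l2 -> t < pi ->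
  u p = 0 -> v p = - d ->
  u t = - d / Num.sqrt b * sin (Num.sqrt b * (t - p)) /\
  v t = - d * cos (Num.sqrt b * (t - p)).
Proof.
move=> p0 pt tp tpi up vp; apply: bump => // x; rewrite in_itv/= => /andP[px xt].
have h : 0 <= d / Num.sqrt b * sin (Num.sqrt b * x + - (Num.sqrt b * p)).
  rewrite mulr_ge0 ?divr_ge0 ?(ltW d0) ?(ltW sb)// sin_bump_ge0 ?(ltW px)//.
  exact: le_trans (ltW xt) tp.
by rewrite !mulNr opprK max_r ?oppr_le0// max_l// mulr0 add0r mulrN.
Qed.

Let sal1 : Num.sqrt a * l1 = pi. Proof. by rewrite mulrC divfK// gt_eqF. Qed.
Let sbl2 : Num.sqrt b * l2 = pi. Proof. by rewrite mulrC divfK// gt_eqF. Qed.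

Let kl_ge0 k : 0 <= k%:R * (l1 + l2).
Proof. by rewrite mulr_ge0// addr_ge0// ltW. Qed.

Let half k : k%:R * (l1 + l2) + l1 < pi ->
  u (k%:R * (l1 + l2)) = 0 -> v (k%:R * (l1 + l2)) = d ->
  u (k%:R * (l1 + l2) + l1) = 0 /\ v (k%:R * (l1 + l2) + l1) = - d.
Proof.
move=> h uk vk; have [|-> ->] := pos_bump (kl_ge0 k) _ (lexx _) h uk vk.
  by rewrite lerDl ltW.
by rewrite [_ + l1]addrC addrK sal1 sinpi cospi mulr0 mulrN1.
Qed.

(** The slope is d, then - d, then d again at successive zeros, so the pattern repeats with period
    l1 + l2. *)
Let zeros k : k%:R * (l1 + l2) < pi ->
  u (k%:R * (l1 + l2)) = 0 /\ v (k%:R * (l1 + l2)) = d.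
Proof.
elim: k => [_|k IH].
  by rewrite mul0r /v eqxx; case: sol.
rewrite -natr1 mulrDl mul1r addrA => h.
have [|uk vk] := IH; first by apply: lt_trans h; rewrite -addrA ltrDl addr_gt0.
have h1 : k%:R * (l1 + l2) + l1 < pi by apply: lt_trans h; rewrite ltrDl.
have [uk1 vk1] := half h1 uk vk.
have [||-> ->] := neg_bump _ _ (lexx _) h uk1 vk1.
- by rewrite addr_ge0// ltW.
- by rewrite lerDl ltW.
by rewrite [_ + l2 - _]addrAC subrr add0r sbl2 sinpi cospi mulr0 mulrN1 opprK.
Qed.

Lemma fucik_solution_pos k x : k%:R * (l1 + l2) <= x -> x <= k%:R * (l1 + l2) + l1 ->
  x < pi -> u x = d / Num.sqrt a * sin (Num.sqrt a * (x - k%:R * (l1 + l2))).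
Proof.
move=> kx xk xpi; have [uk vk] := zeros (le_lt_trans kx xpi).
by have [] := pos_bump (kl_ge0 k) kx xk xpi uk vk.
Qed.

Lemma fucik_solution_neg k x : k%:R * (l1 + l2) + l1 <= x ->
  x <= k%:R * (l1 + l2) + l1 + l2 -> x < pi ->
  u x = - (d / Num.sqrt b) * sin (Num.sqrt b * (x - (k%:R * (l1 + l2) + l1))).
Proof.
move=> kx xk xpi; have kpi := le_lt_trans kx xpi.
have [|uk vk] := @zeros k; first by apply: lt_trans kpi; rewrite ltrDl.
have [uk1 vk1] := half kpi uk vk.
have [|-> _] := neg_bump _ kx xk xpi uk1 vk1; last by rewrite mulNr.
by rewrite addr_ge0// ltW.
Qed.

(** As l1 + l2 <= pi, one full positive and one full negative bump fit in [0, pi], so both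
    amplitudes are attained, at l1 / 2 and at l1 + l2 / 2. *)
Lemma fucik_amplitude : l1 + l2 <= pi -> sup [set `|u x| | x in `[0, pi]] = 1 ->
  Num.max (d / Num.sqrt a) (d / Num.sqrt b) = 1.
Proof.
move=> lpi supu.
set M := Num.max _ _.
have A0 : 0 < d / Num.sqrt a by rewrite divr_gt0.
have B0 : 0 < d / Num.sqrt b by rewrite divr_gt0.
have AM : d / Num.sqrt a <= M by rewrite le_max lexx.
have BM : d / Num.sqrt b <= M by rewrite le_max lexx orbT.
have ubM : ubound [set `|u x| | x in `[0, pi]] M.
  move=> _ [x + <-]; rewrite /= in_itv/= => /andP[x0].
  rewrite le_eqVlt => /predU1P[->|xpi].
    by case: sol => _ _ _ ->; rewrite normr0 (le_trans (ltW A0)).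
  have l0 : 0 < l1 + l2 by rewrite addr_gt0.
  pose k := Num.truncn (x / (l1 + l2)).
  have /andP[kx xk] := truncn_itv (divr_ge0 x0 (ltW l0)).
  rewrite ler_pdivlMr// in kx; rewrite ltr_pdivrMr// -natr1 mulrDl mul1r addrA in xk.
  have [xk1|xk1] := leP x (k%:R * (l1 + l2) + l1).
    rewrite (fucik_solution_pos kx xk1 xpi) normrM (gtr0_norm A0).
    by rewrite (le_trans _ AM)// ler_piMr ?(ltW A0)// sin_max.
  rewrite (fucik_solution_neg (ltW xk1) (ltW xk) xpi) normrM normrN (gtr0_norm B0).
  by rewrite (le_trans _ BM)// ler_piMr ?(ltW B0)// sin_max.
apply/eqP; rewrite eq_le; apply/andP; split; last first.
  rewrite -supu ge_sup//; exists `|u 0|; exists 0 => //=.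
  by rewrite in_itv/= lexx pi_ge0.
have le_sup x : 0 <= x <= pi -> `|u x| <= 1.
  move=> xI; rewrite -supu; apply: ub_le_sup; first by exists M.
  by exists x => //=; rewrite in_itv.
rewrite /M ge_max; apply/andP; split.
  have := @le_sup (l1 / 2); rewrite (@fucik_solution_pos 0); last 3 first.
  - by rewrite mul0r divr_ge0// ltW.
  - by rewrite mul0r add0r ler_pdivrMr// ler_peMr ?(ltW l1_gt0)// ler1n.
  - by move: l1_gt0 l2_gt0 lpi; lra.
  rewrite mul0r subr0 mulrA sal1 sin_pihalf mulr1 gtr0_norm//; apply.
  by move: l1_gt0 l2_gt0 lpi => ? ? ?; apply/andP; split; lra.
have := @le_sup (l1 + l2 / 2); rewrite (@fucik_solution_neg 0); last 3 first.
- by rewrite mul0r add0r lerDl divr_ge0// ltW.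
- by rewrite mul0r add0r lerD2l ler_pdivrMr// ler_peMr ?(ltW l2_gt0)// ler1n.
- by move: l1_gt0 l2_gt0 lpi; lra.
rewrite mul0r add0r [l1 + _]addrC addrK mulrA sbl2 sin_pihalf mulr1 normrN gtr0_norm//; apply.
by move: l1_gt0 l2_gt0 lpi => ? ? ?; apply/andP; split; lra.
Qed.

End fucik_explicit.

(** * Distance to the sines *)

Section trigo_bounds.
Context {R : realType}.
Implicit Types (x y s t A : R).

Lemma ler_norm_sin x : `|sin x| <= `|x|.
Proof.
wlog x0 : x / 0 <= x.
  move=> h; have [/h//|/ltW x0] := leP 0 x.
  by rewrite -normrN -sinN -(normrN x) h// oppr_ge0.
have [|c _] := @MVT_segment _ sin cos 0 x x0 (fun y _ => is_derive_sin y).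
  exact/continuous_subspaceT/continuous_sin.
by rewrite sin0 !subr0 => ->; rewrite normrM ler_piMl// cos_max.
Qed.

(** Half angle: cos x = 1 - 2 sin^2 (x / 2), with |sin (x / 2)| <= |x / 2|. *)
Lemma cos_ge x : 1 - x ^+ 2 / 2 <= cos x.
Proof.
have -> : x = (x / 2) *+ 2 by rewrite mulr2n -splitr.
rewrite cos_mulr2n; have := ler_norm_sin (x / 2).
rewrite -ler_sqr ?nnegrE// !real_normK ?num_real// => h.
by move: (x / 2) h => y h; have := cos2Dsin2 y; lra.
Qed.

(** Adding the square of A cos s - cos t gives (1 - A)^2 + 2 A (1 - cos (s - t)), to which [cos_ge]
    applies. *)
Lemma sin_dist A s t : 0 <= A ->
  (A * sin s - sin t) ^+ 2 <= (1 - A) ^+ 2 + A * (s - t) ^+ 2.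
Proof.
move=> A0; have h1 := sqr_ge0 (A * cos s - cos t).
have h2 := ler_wpM2l A0 (cos_ge (s - t)); rewrite cosB in h2.
have h3 := cos2Dsin2 s; have h4 := cos2Dsin2 t.
have : (A * sin s - sin t) ^+ 2 + (A * cos s - cos t) ^+ 2 =
  A ^+ 2 * (cos s ^+ 2 + sin s ^+ 2) + (cos t ^+ 2 + sin t ^+ 2)
    - 2 * (A * (cos s * cos t + sin s * sin t)) by ring.
rewrite h3 h4; nra.
Qed.

Lemma sinD_natpi x k : sin (x + k%:R * pi) = (-1) ^+ k * sin x.
Proof. by rewrite sinD sin_natpi cos_natpi mulr0 addr0 mulrC. Qed.

Lemma pi_sqr_ge8 : 8 <= pi ^+ 2 :> R.
Proof. by have := cos_ge (pi / 2); rewrite cos_pihalf; nra. Qed.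

(* x cos x <= sin x at x = pi / 6, where tan x = 1 / sqrt 3. *)
Lemma pi_sqr_le12 : pi ^+ 2 <= 12 :> R.
Proof.
pose x : R := pi / 6.
have p0 := pi_gt0 R; have x0 : 0 < x by rewrite divr_gt0.
have s0 : 0 < sin x by apply: sin_gt0_pi; rewrite x0/= /x; lra.
have c0 : 0 < cos x by apply: cos_gt0_pihalf; apply/andP; split; rewrite /x; lra.
(* pi / 2 - pi / 6 is twice pi / 6, so s = sin x satisfies s = 1 - 2 s^2, whose positive root is 1 /
   2. *)
have h1 : sin x = cos (x *+ 2).
  have -> : x *+ 2 = - (x - pi / 2) by rewrite mulr2n /x; field.
  by rewrite cosN cosBpihalf.
have h2 := cos2Dsin2 x; rewrite cos_mulr2n mulr2n in h1.
have s2 : sin x = 1 / 2 by nra.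
have [|c] := @MVT _ sin cos 0 x x0 (fun y _ => is_derive_sin y).
  exact/continuous_subspaceT/continuous_sin.
rewrite in_itv/= sin0 !subr0 => /andP[c_gt0 cx] E.
have h3 : cos x <= cos c.
  by rewrite ltW// ltr_cos// in_itv/=; apply/andP; split; rewrite /x in x0 cx *; lra.
have h4 : cos x * x <= 1 / 2 by rewrite -s2 E ler_pM2r.
have h5 : (cos x * x) ^+ 2 <= (1 / 2) ^+ 2.
  by rewrite ler_sqr ?nnegrE// mulr_ge0// ltW.
have h6 : cos x ^+ 2 = 3 / 4 by rewrite s2 in h2; lra.
move: h5; rewrite exprMn h6 /x; lra.
Qed.

End trigo_bounds.

(** * Integrating the phase error over the bumps *)

Section phase.
Context {R : realType}.
Let mu := @lebesgue_measure R.
Implicit Types (A B x y : R) (k m : nat).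

(** [D] is the phase error at the left end and [s] its slope; the right side is the exact integral
    of the quadratic bound. Half-open intervals let consecutive bumps be joined without overlap. *)
Lemma integral_bump (f : R -> R) (p l c D s : R) : 0 <= l ->
  measurable_fun `[p, p + l[ f ->
  (forall x : R, p <= x -> x < p + l -> 0 <= f x <= c + (D + s * (x - p)) ^+ 2) ->
  (\int[mu]_(x in `[p, (p + l)%R[) (f x)%:E <=
   (l * (c + (D ^+ 2 + D * (s * l) + (s * l) ^+ 2 / 3)))%:E)%E.
Proof.
move=> l0 mf hf.
pose g x := c + (D + s * (x - p)) ^+ 2.
pose q : {poly R} := (c + (D - s * p) ^+ 2)%:P
  + (2 * (D - s * p) * s) *: 'X + (s ^+ 2) *: 'X^2.
pose Q : {poly R} := (c + (D - s * p) ^+ 2) *: 'X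
  + ((D - s * p) * s) *: 'X^2 + (s ^+ 2 / 3) *: 'X^3.
have qg x : q.[x] = g x by rewrite /q !(hornerD, hornerZ, hornerC, hornerX, hornerXn) /g; ring.
have cg : continuous g.
  have -> : g = horner q by apply/funext => x; rewrite qg.
  exact: is_derive_continuous (is_derive_poly q).
have dQ (x : R) : is_derive x 1 (horner Q) (g x).
  apply: eq_is_derive (is_derive_poly Q x) _ _ => //.
  rewrite /Q !(derivD, derivZ, derivX, derivXn).
  rewrite !(hornerD, hornerZ, hornerC, hornerX, hornerXn, hornerMn).
  by rewrite /g /=; field.
apply: (@le_trans _ _ (\int[mu]_(x in `[p, (p + l)%R[) (g x)%:E)%E).
  apply: ge0_le_integral => //=.
  - by move=> x; rewrite in_itv/= => /andP[px xl]; have /andP[] := hf x px xl.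
  - exact/measurable_EFinP.
  - apply/measurable_EFinP; apply: measurable_funTS.
    exact: continuous_measurable_fun.
  - by move=> x; rewrite in_itv/= => /andP[px xl]; have /andP[] := hf x px xl.
have pl : p <= p + l by rewrite lerDl.
rewrite integral_itv_bndo_bndc; last first.
  apply/measurable_EFinP; apply: measurable_funTS.
  exact: continuous_measurable_fun.
rewrite (integral_itv_is_derive pl dQ cg) lee_fin le_eqVlt; apply/orP; left.
by apply/eqP; rewrite /Q !(hornerD, hornerZ, hornerC, hornerX, hornerXn); field.
Qed.

Section bumps.
(** Here [a] and [b] are the frequencies on the bumps, that is, the square roots of the Fucik
    parameters. *)
Variables (u : R -> R) (n : nat) (a b l1 l2 A B : R).
Let l := l1 + l2.
Hypotheses (l1_ge0 : 0 <= l1) (l2_ge0 : 0 <= l2) (al1 : a * l1 = pi) (bl2 : b * l2 = pi)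
  (A01 : 0 <= A <= 1) (B01 : 0 <= B <= 1)
  (mu_u : measurable_fun `[0, pi[ u)
  (upos : forall k x, k%:R * l <= x -> x <= k%:R * l + l1 -> x < pi ->
    u x = A * sin (a * (x - k%:R * l)))
  (uneg : forall k x, k%:R * l + l1 <= x -> x <= k%:R * l + l1 + l2 -> x < pi ->
    u x = - B * sin (b * (x - (k%:R * l + l1)))).

Let f x := (u x - sines n x) ^+ 2.
Let J x := (\int[mu]_(x in `[0%R, x[) (f x)%:E)%E.

Let mf x y : 0 <= x -> y <= pi -> measurable_fun `[x, y[ f.
Proof.
move=> x0 ypi; apply: (@measurable_funS _ _ _ _ `[0, pi[) => //.
  by apply: subset_itv; rewrite bnd_simp.
apply: measurable_funX; apply: measurable_funB => //.
by apply: measurable_funTS; apply: continuous_measurable_fun; exact: continuous_sines.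
Qed.

Let J_cat x y : 0 <= x -> x <= y -> y <= pi ->
  (J y = J x + \int[mu]_(z in `[x, y[) (f z)%:E)%E.
Proof.
move=> x0 xy ypi; rewrite /J -ge0_integral_setU//=.
- rewrite -itv_bndbnd_setU// bnd_simp//.
- rewrite -itv_bndbnd_setU ?bnd_simp//.
  by apply/measurable_EFinP; exact: mf.
- by move=> z _; rewrite lee_fin sqr_ge0.
- rewrite disj_set2E; apply/eqP; rewrite -subset0 => z /=.
  by rewrite !in_itv/= => -[/andP[_ zx] /andP[xz _]]; move: xz; rewrite leNgt zx.
Qed.

(** On a positive bump n x gains n l1 and theta gains pi. [P] and [Q] are the excesses over the two
    kinds of bump and [T] is the drift per pair, so theta x - n x equals - k T at the start of the
    k-th pair. *)
Let P := n%:R * l1 - pi.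
Let Q := n%:R * l2 - pi.
Let T := P + Q.

(* Upper bounds for the integral of f over the k-th positive and negative bump;
   the quadratic part is the integral of the squared phase difference. *)
Definition pos_bound k : R :=
  l1 * ((1 - A) ^+ 2 + ((k%:R * T) ^+ 2 + k%:R * T * P + P ^+ 2 / 3)).
Definition neg_bound k : R :=
  l2 * ((1 - B) ^+ 2 + ((k%:R * T + P) ^+ 2 + (k%:R * T + P) * Q + Q ^+ 2 / 3)).

Let sin_dist1 (C s t : R) : 0 <= C <= 1 -> (C * sin s - sin t) ^+ 2 <= (1 - C) ^+ 2 + (s - t) ^+ 2.
Proof.
move=> /andP[C0 C1]; rewrite (le_trans (sin_dist s t C0))// lerD2l.
by rewrite ler_piMl// sqr_ge0.
Qed.

(** Adding 2 k pi on positive bumps and (2 k + 1) pi on negative ones makes the phase continuous and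
    absorbs the sign. *)
Let sin_even k x : sin x = sin (x + (k.*2)%:R * pi).
Proof. by rewrite sinD_natpi -signr_odd odd_double mul1r. Qed.

Let sin_odd k x : - sin x = sin (x + (k.*2.+1)%:R * pi).
Proof. by rewrite sinD_natpi -signr_odd/= odd_double mulN1r. Qed.

Let kl_ge0 k : 0 <= k%:R * l.
Proof. by rewrite mulr_ge0// addr_ge0. Qed.

Lemma integral_pos_bump k : k%:R * l + l1 <= pi ->
  (J (k%:R * l + l1) <= J (k%:R * l)%R + (pos_bound k)%:E)%E.
Proof.
move=> kpi; have kl1 : k%:R * l <= k%:R * l + l1 by rewrite lerDl.
rewrite (J_cat (kl_ge0 k) kl1 kpi) leeD2l//.
apply: le_trans (integral_bump (c := (1 - A) ^+ 2) (D := - (k%:R * T)) (s := a - n%:R) l1_ge0 _ _) _.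
- exact: mf.
- move=> x kx xk; have xpi := lt_le_trans xk kpi.
  rewrite sqr_ge0/= /f (upos kx (ltW xk) xpi) (sin_even k) /sines.
  apply: (le_trans (sin_dist1 _ _ A01)); rewrite lerD2l le_eqVlt; apply/orP; left.
  apply/eqP; congr (_ ^+ 2); rewrite -muln2 natrM /T /P /Q /l; ring.
rewrite lee_fin /pos_bound mulrBl al1 le_eqVlt; apply/orP; left; apply/eqP.
by rewrite /P; field.
Qed.

Lemma integral_neg_bump k : k%:R * l + l1 + l2 <= pi ->
  (J (k%:R * l + l1 + l2) <= J (k%:R * l + l1)%R + (neg_bound k)%:E)%E.
Proof.
move=> kpi; have kl1 : k%:R * l + l1 <= k%:R * l + l1 + l2 by rewrite lerDl.
rewrite (J_cat (addr_ge0 (kl_ge0 k) l1_ge0) kl1 kpi) leeD2l//.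
apply: le_trans (integral_bump (c := (1 - B) ^+ 2) (D := - (k%:R * T + P)) (s := b - n%:R) l2_ge0 _ _) _.
- by apply: mf => //; exact: addr_ge0.
- move=> x kx xk; have xpi := lt_le_trans xk kpi.
  rewrite sqr_ge0/= /f (uneg kx (ltW xk) xpi) mulNr -mulrN (sin_odd k) /sines.
  apply: (le_trans (sin_dist1 _ _ B01)); rewrite lerD2l le_eqVlt; apply/orP; left.
  apply/eqP; congr (_ ^+ 2); rewrite -natr1 -muln2 natrM /T /P /Q /l; ring.
rewrite lee_fin /neg_bound mulrBl bl2 le_eqVlt; apply/orP; left; apply/eqP.
by rewrite /Q; field.
Qed.

Lemma integral_bumps k : k%:R * l <= pi ->
  (J (k%:R * l)%R <= (\sum_(0 <= j < k) (pos_bound j + neg_bound j))%:E)%E.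
Proof.
elim: k => [_|k IH]; first by rewrite mul0r /J set_itv_ge ?bnd_simp ?ltxx// integral_set0 big_geq.
rewrite -natr1 mulrDl mul1r /l addrA -/l big_nat_recr//= => h.
apply: (le_trans (integral_neg_bump h)); rewrite addrA EFinD leeD2r//.
have h1 : k%:R * l + l1 <= pi by apply: le_trans h; rewrite lerDl.
apply: (le_trans (integral_pos_bump h1)); rewrite EFinD leeD2r//.
by apply: IH; apply: le_trans h1; rewrite lerDl.
Qed.

(** Sums of j and j^2 in closed form. Each of them carries a factor [T], which is 0 for even n. *)
Lemma sum_bump_bounds k : \sum_(0 <= j < k) (pos_bound j + neg_bound j) =
  k%:R * (l1 * (1 - A) ^+ 2 + l2 * (1 - B) ^+ 2)
  + l * (T ^+ 2 * (k%:R * (k%:R - 1) * (2 * k%:R - 1) / 6))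
  + l1 * (T * P * (k%:R * (k%:R - 1) / 2) + k%:R * P ^+ 2 / 3)
  + l2 * (T * (2 * P + Q) * (k%:R * (k%:R - 1) / 2) + k%:R * (P ^+ 2 + P * Q + Q ^+ 2 / 3)).
Proof.
elim: k => [|k IH]; first by rewrite big_geq//; ring.
by rewrite big_nat_recr//= IH /pos_bound /neg_bound /l -natr1; field.
Qed.

End bumps.
End phase.

(** * From the bump sums to the constants of [fucik_C] *)

Section numeric.
Context {R : realType}.
Implicit Types (X : R).

Let le_pi X (e : R) : 0 <= e -> 0 <= X -> X * (1 + e) = pi -> X <= pi /\ X ^+ 2 <= pi ^+ 2.
Proof.
move=> e0 X0 E; have h : X <= pi by rewrite -E ler_peMr// lerDl.
by split => //; rewrite ler_sqr ?nnegrE// pi_ge0.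
Qed.

(** [e] is the excess of the larger frequency over n, relative to n. Then l2 = l1 (1 + 2 e), the
    amplitude defect is at most 2 e and the phase excess is at most e pi in size. The total pi e^2
    (2 + pi^2 / 3) stays below the constant once pi^2 >= 6. *)
Lemma even_bound (m l1 l2 e : R) : 0 < m -> 0 < l1 -> 0 <= e ->
  m * (l1 + l2) = pi -> 2 * m * l1 * (1 + e) = pi ->
  m * (l1 * (1 - l1 / l2) ^+ 2) + pi * ((2 * m * l1 - pi) ^+ 2 / 3)
    <= 4 * (3 + pi ^+ 2) * pi / 9 * e ^+ 2.
Proof.
move=> m0 l10 e0 E1 E2; have X0 : 0 <= 2 * m * l1 by rewrite !mulr_ge0// ltW.
have [Xpi Xpi2] := le_pi e0 X0 E2.
have e1 : 0 < 1 + 2 * e by rewrite ltr_pwDl// mulr_ge0.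
have -> : l2 = l1 * (1 + 2 * e).
  apply: (mulfI (lt0r_neq0 m0)); lra.
have -> : l1 / (l1 * (1 + 2 * e)) = (1 + 2 * e)^-1 by rewrite invfM mulVKf// gt_eqF.
have -> : 2 * m * l1 - pi = - (e * (2 * m * l1)) by lra.
have h1 : (1 - (1 + 2 * e)^-1) ^+ 2 <= (2 * e) ^+ 2.
  have -> : 1 - (1 + 2 * e)^-1 = 2 * e / (1 + 2 * e) by field; rewrite gt_eqF.
  rewrite ler_sqr ?nnegrE ?divr_ge0 ?mulr_ge0 ?(ltW e1)//.
  by rewrite ler_pdivrMr// ler_peMr ?mulr_ge0// lerDl mulr_ge0.
have h2 : m * l1 * (1 - (1 + 2 * e)^-1) ^+ 2 <= pi / 2 * (2 * e) ^+ 2.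
  by apply: ler_pM => //; [rewrite mulr_ge0// ltW|exact: sqr_ge0|lra].
have h3 : pi * (e ^+ 2 * (2 * m * l1) ^+ 2) <= pi * (e ^+ 2 * pi ^+ 2).
  by rewrite ler_wpM2l ?ler_wpM2l ?sqr_ge0 ?pi_ge0.
have h4 : 0 <= pi * e ^+ 2 * (pi ^+ 2 - 8).
  by rewrite !mulr_ge0 ?sqr_ge0 ?pi_ge0// subr_ge0 pi_sqr_ge8.
have h5 : 0 <= pi * e ^+ 2 by rewrite mulr_ge0 ?sqr_ge0 ?pi_ge0.
rewrite sqrrN exprMn; lra.
Qed.

(** Everything comes from m (l2 - l1) = e n l1: the amplitude defect is at most e n / m, and the
    drift n (l1 + l2) - 2 pi = l2 - l1 is e n l1 / m. *)
Lemma odd_bound_ge (m n l1 l2 e : R) : 0 < m -> n = 2 * m + 1 -> 0 < l1 -> 0 <= e ->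
  (m + 1) * l1 + m * l2 = pi -> n * l1 * (1 + e) = pi ->
  (m + 1) * (l1 * (1 - l1 / l2) ^+ 2)
    + pi * (n * (l1 + l2) - 2 * pi) ^+ 2 * (m * (m + 1) / 6)
    <= 4 * pi * (n ^+ 2 * (n ^+ 2 + 1) / (n - 1) ^+ 4) * e ^+ 2.
Proof.
move=> m0 nE l10 e0 E1 E2.
have n0 : 0 < n by rewrite nE; lra.
have X0 : 0 <= n * l1 by rewrite mulr_ge0// ltW.
have [Xpi Xpi2] := le_pi e0 X0 E2.
have E3 : m * (l2 - l1) = e * (n * l1) by rewrite nE in E2 *; lra.
have l21 : l1 <= l2 by rewrite -subr_ge0 -(pmulr_rge0 _ m0) E3 mulr_ge0.
have l20 : 0 < l2 by exact: lt_le_trans l21.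
have h1 : (1 - l1 / l2) ^+ 2 <= (e * n / m) ^+ 2.
  have -> : 1 - l1 / l2 = (e * n / m) * (l1 / l2).
    have -> : e * n / m * (l1 / l2) = (e * (n * l1)) / (m * l2) by field; rewrite !gt_eqF.
    by rewrite -E3; field; rewrite !gt_eqF.
  have c0 : 0 <= e * n / m by rewrite divr_ge0 ?mulr_ge0// ltW.
  have c1 : 0 <= l1 / l2 by rewrite divr_ge0// ltW.
  rewrite ler_sqr ?nnegrE//; last exact: mulr_ge0.
  by rewrite ler_piMr// ler_pdivrMr// mul1r.
have h2 : (m + 1) * l1 <= (m + 1) * (pi / n).
  by rewrite ler_wpM2l ?addr_ge0 ?(ltW m0)// ler_pdivlMr// mulrC.
have h3 : (m + 1) * l1 * (1 - l1 / l2) ^+ 2 <= (m + 1) * (pi / n) * (e * n / m) ^+ 2.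
  by apply: ler_pM => //; [rewrite mulr_ge0 ?addr_ge0 ?(ltW m0) ?(ltW l10)|exact: sqr_ge0].
have ET : n * (l1 + l2) - 2 * pi = e * (n * l1) / m.
  rewrite -E3 [RHS]mulrAC mulfV ?gt_eqF// mul1r -E1 nE; lra.
have h4 : (e * (n * l1) / m) ^+ 2 <= e ^+ 2 * 12 / m ^+ 2.
  rewrite expr_div_n exprMn; apply: ler_wpM2r; first by rewrite invr_ge0 sqr_ge0.
  by apply: ler_wpM2l; [exact: sqr_ge0|exact: le_trans Xpi2 pi_sqr_le12].
have h5 : pi * (e * (n * l1) / m) ^+ 2 * (m * (m + 1) / 6) <=
    pi * (e ^+ 2 * 12 / m ^+ 2) * (m * (m + 1) / 6).
  apply: ler_wpM2r; last by apply: ler_wpM2l; first exact: pi_ge0.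
  by rewrite divr_ge0// mulr_ge0 ?addr_ge0// ltW.
rewrite ET mulrA; apply: (le_trans (lerD h3 h5)).
have -> : (m + 1) * (pi / n) * (e * n / m) ^+ 2 +
    pi * (e ^+ 2 * 12 / m ^+ 2) * (m * (m + 1) / 6) =
    pi * e ^+ 2 * (16 * m ^+ 2 * ((m + 1) * n + 2 * m * (m + 1))) / (16 * m ^+ 4).
  by field; rewrite !gt_eqF.
have -> : 4 * pi * (n ^+ 2 * (n ^+ 2 + 1) / (n - 1) ^+ 4) * e ^+ 2 =
    pi * e ^+ 2 * (4 * (n ^+ 2 * (n ^+ 2 + 1))) / (16 * m ^+ 4).
  have -> : n - 1 = 2 * m by rewrite nE; lra.
  by field; rewrite !gt_eqF.
apply: ler_wpM2r; first by rewrite invr_ge0 mulr_ge0 ?exprn_ge0// ltW.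
apply: ler_wpM2l; first by rewrite mulr_ge0 ?sqr_ge0 ?pi_ge0.
(* What remains is 64 m^4 + 80 m^3 + 16 m^2 <= 64 m^4 + 128 m^3 + 112 m^2 + 48 m + 8. The leading
   terms agree: a bound on pi^2 above 12 would break this chain for large m. *)
have m2 : 0 <= m ^+ 2 by exact: sqr_ge0.
have m3 : 0 <= m ^+ 3 by rewrite exprn_ge0// ltW.
rewrite nE; nra.
Qed.

Lemma odd_bound_lt (m n l1 l2 e : R) : 1 <= m -> n = 2 * m + 1 -> 0 < l2 -> 0 <= e ->
  (m + 1) * l1 + m * l2 = pi -> n * l2 * (1 + e) = pi ->
  m * (l2 * (1 - l2 / l1) ^+ 2)
    + pi * (n * (l1 + l2) - 2 * pi) ^+ 2 * (m * (m + 1) / 6)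
    <= 5 * pi * (n ^+ 2 * (n ^+ 2 + 1) / (n + 1) ^+ 4) * e ^+ 2.
Proof.
move=> m1 nE l20 e0 E1 E2.
have m0 : 0 < m by lra.
have M0 : 0 < m + 1 by lra.
have n0 : 0 < n by rewrite nE; lra.
have X0 : 0 <= n * l2 by rewrite mulr_ge0// ltW.
have [Xpi Xpi2] := le_pi e0 X0 E2.
have E3 : (m + 1) * (l1 - l2) = e * (n * l2) by rewrite nE in E2 *; lra.
have l21 : l2 <= l1 by rewrite -subr_ge0 -(pmulr_rge0 _ M0) E3 mulr_ge0.
have l10 : 0 < l1 by exact: lt_le_trans l21.
have h1 : (1 - l2 / l1) ^+ 2 <= (e * n / (m + 1)) ^+ 2.
  have -> : 1 - l2 / l1 = (e * n / (m + 1)) * (l2 / l1).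
    have -> : e * n / (m + 1) * (l2 / l1) = (e * (n * l2)) / ((m + 1) * l1) by field; rewrite !gt_eqF.
    by rewrite -E3; field; rewrite !gt_eqF.
  have c0 : 0 <= e * n / (m + 1) by rewrite divr_ge0 ?mulr_ge0// ltW.
  have c1 : 0 <= l2 / l1 by rewrite divr_ge0// ltW.
  rewrite ler_sqr ?nnegrE//; last exact: mulr_ge0.
  by rewrite ler_piMr// ler_pdivrMr// mul1r.
have h2 : m * l2 <= m * (pi / n).
  by rewrite ler_wpM2l ?(ltW m0)// ler_pdivlMr// mulrC.
have h3 : m * l2 * (1 - l2 / l1) ^+ 2 <= m * (pi / n) * (e * n / (m + 1)) ^+ 2.
  by apply: ler_pM => //; [rewrite mulr_ge0 ?(ltW m0) ?(ltW l20)|exact: sqr_ge0].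
have ET : n * (l1 + l2) - 2 * pi = - (e * (n * l2) / (m + 1)).
  rewrite -E3 mulrAC mulfV ?gt_eqF// mul1r -E1 nE; lra.
have h4 : (e * (n * l2) / (m + 1)) ^+ 2 <= e ^+ 2 * 12 / (m + 1) ^+ 2.
  rewrite expr_div_n exprMn; apply: ler_wpM2r; first by rewrite invr_ge0 sqr_ge0.
  by apply: ler_wpM2l; [exact: sqr_ge0|exact: le_trans Xpi2 pi_sqr_le12].
have h5 : pi * (e * (n * l2) / (m + 1)) ^+ 2 * (m * (m + 1) / 6) <=
    pi * (e ^+ 2 * 12 / (m + 1) ^+ 2) * (m * (m + 1) / 6).
  apply: ler_wpM2r; last by apply: ler_wpM2l; first exact: pi_ge0.
  by rewrite divr_ge0// mulr_ge0 ?addr_ge0// ltW.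
rewrite ET sqrrN mulrA; apply: (le_trans (lerD h3 h5)).
have -> : m * (pi / n) * (e * n / (m + 1)) ^+ 2 +
    pi * (e ^+ 2 * 12 / (m + 1) ^+ 2) * (m * (m + 1) / 6) =
    pi * e ^+ 2 * (16 * (m + 1) ^+ 2 * (m * n + 2 * m * (m + 1))) / (16 * (m + 1) ^+ 4).
  by field; rewrite !gt_eqF.
have -> : 5 * pi * (n ^+ 2 * (n ^+ 2 + 1) / (n + 1) ^+ 4) * e ^+ 2 =
    pi * e ^+ 2 * (5 * (n ^+ 2 * (n ^+ 2 + 1))) / (16 * (m + 1) ^+ 4).
  have -> : n + 1 = 2 * (m + 1) by rewrite nE; lra.
  by field; rewrite !gt_eqF.
apply: ler_wpM2r; first by rewrite invr_ge0 mulr_ge0 ?exprn_ge0// ltW.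
apply: ler_wpM2l; first by rewrite mulr_ge0 ?sqr_ge0 ?pi_ge0.
(* In t = m - 1 the right side minus the left is 16 t^4 + 48 t^3 + (14 t - 3)^2 / 7 + 5 / 7. With 4
   in place of the factor 5 the cubic terms would go the wrong way. *)
rewrite nE; pose t := m - 1; have -> : m = 1 + t by rewrite /t; ring.
have t0 : 0 <= t by rewrite /t; lra.
have t3 : 0 <= t ^+ 3 by rewrite exprn_ge0.
have t4 : 0 <= t ^+ 4 by rewrite exprn_ge0.
have t2 := sqr_ge0 (14 * t - 3).
nra.
Qed.

End numeric.

(** * Distance of one eigenfunction to its sine *)

Section distance.
Context {R : realType}.
Let mu := @lebesgue_measure R.

Lemma measurable_within_continuous (u : R -> R) (p q : R) :
  {within `[p, q], continuous u} -> measurable_fun `[p, q] u.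
Proof. by move=> cu; apply: subspace_continuous_measurable_fun => //; exact: cu. Qed.

Lemma L2_0pi_within_continuous (u : R -> R) :
  {within `[0, pi], continuous u} -> L2_0pi u.
Proof.
move=> cu.
have [M _ hM] := within_continuous_bounded (pi_ge0 R) cu.
apply: (@L2_0pi_measurable_bounded _ _ M).
  apply: measurable_funS (measurable_within_continuous cu) => //.
  by apply: subset_itv; rewrite bnd_simp.
move=> x xI; apply: hM.
by move: xI; rewrite /= !in_itv/= => /andP[/ltW-> /ltW->].
Qed.

Lemma eq_L2_0pi (f g : R -> R) : (forall x, `]0, pi[%classic x -> f x = g x) ->
  L2_0pi f = L2_0pi g.
Proof.
move=> fg; rewrite /L2_0pi; have -> // : f \_ `]0, pi[ = g \_ `]0, pi[; apply/funext => x.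
by rewrite /patch; case: ifPn => //; rewrite inE => /fg.
Qed.

Lemma eq_nrm (f g : R -> R) : (forall x, `]0, pi[%classic x -> f x = g x) ->
  nrm f = nrm g.
Proof.
move=> fg; rewrite /nrm /L2norm_0pi.
have -> // : f \_ `]0, pi[ = g \_ `]0, pi[; apply/funext => x.
by rewrite /patch; case: ifPn => //; rewrite inE => /fg.
Qed.

Lemma nrm0 : nrm (fun=> 0 : R) = 0.
Proof.
have := nrmZ 0 (@L2_0pi0 R); rewrite normr0 mul0r; apply: etrans.
by apply: eq_nrm => x _; rewrite /= scaler0.
Qed.

(** * Fucik eigenfunctions *)

Section eigenfunction.
Variables (n : nat) (a b d : R) (u : R -> R).
Hypotheses (a0 : 0 < a) (b0 : 0 < b) (d0 : 0 < d)
  (sol : fucik_solution a b u) (rd : right_derivative_at0 u d)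
  (supu : sup [set `|u x| | x in `[0, pi]] = 1).
Let l1 := pi / Num.sqrt a.
Let l2 := pi / Num.sqrt b.
Let A := d / Num.sqrt a.
Let B := d / Num.sqrt b.
Let P := n%:R * l1 - pi.
Let Q := n%:R * l2 - pi.
Hypothesis lpi : l1 + l2 <= pi.

Let sa : 0 < Num.sqrt a. Proof. by rewrite sqrtr_gt0. Qed.
Let sb : 0 < Num.sqrt b. Proof. by rewrite sqrtr_gt0. Qed.
Let l1_gt0 : 0 < l1. Proof. by rewrite divr_gt0 ?pi_gt0. Qed.
Let l2_gt0 : 0 < l2. Proof. by rewrite divr_gt0 ?pi_gt0. Qed.
Let al1 : Num.sqrt a * l1 = pi. Proof. by rewrite mulrC divfK// gt_eqF. Qed.
Let bl2 : Num.sqrt b * l2 = pi. Proof. by rewrite mulrC divfK// gt_eqF. Qed.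
Let maxAB : Num.max A B = 1. Proof. exact: (fucik_amplitude a0 b0 d0 sol rd lpi supu). Qed.
Let A0 : 0 < A. Proof. exact: divr_gt0. Qed.
Let B0 : 0 < B. Proof. exact: divr_gt0. Qed.
Let A01 : 0 <= A <= 1. Proof. by rewrite (ltW A0) -maxAB le_max lexx. Qed.
Let B01 : 0 <= B <= 1. Proof. by rewrite (ltW B0) -maxAB le_max lexx orbT. Qed.

Let cu : {within `[0, pi], continuous u}. Proof. by case: sol => -[]. Qed.
Let mu_u : measurable_fun `[0, pi[ u.
Proof.
apply: measurable_funS (measurable_within_continuous cu) => //.
by apply: subset_itv; rewrite bnd_simp.
Qed.

(** Both bumps have the same slope d at their zeros, so the amplitudes are proportional to the
    lengths l1 and l2, and the larger one is 1. *)
Lemma amplitude_ge : Num.sqrt b <= Num.sqrt a -> A = l1 / l2 /\ B = 1.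
Proof.
move=> ba; have AB : A <= B by rewrite ler_wpM2l ?(ltW d0)// lef_pV2.
have B1 : B = 1 by rewrite -maxAB max_r.
split => //; have -> : A = B * (Num.sqrt b / Num.sqrt a).
  by rewrite /A /B; field; rewrite !gt_eqF.
by rewrite B1 /l1 /l2; move: (@pi R) (pi_gt0 R) => p p0; field; rewrite !gt_eqF.
Qed.

Lemma amplitude_lt : Num.sqrt a <= Num.sqrt b -> A = 1 /\ B = l2 / l1.
Proof.
move=> ba; have AB : B <= A by rewrite ler_wpM2l ?(ltW d0)// lef_pV2.
have A1 : A = 1 by rewrite -maxAB max_l.
split => //; have -> : B = A * (Num.sqrt a / Num.sqrt b).
  by rewrite /A /B; field; rewrite !gt_eqF.
by rewrite A1 /l1 /l2; move: (@pi R) (pi_gt0 R) => p p0; field; rewrite !gt_eqF.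
Qed.

Let nrm_dist : ((nrm (u \- sines n) ^+ 2)%:E =
  \int[mu]_(x in `[0%R, pi[) ((u x - sines n x) ^+ 2)%:E)%E.
Proof.
have LB : L2_0pi (u \- sines n).
  by apply: L2_0piB; [exact: L2_0pi_within_continuous|exact: L2_0pi_sines].
rewrite nrm_sqr// integral_itv_obnd_cbnd//; apply/measurable_EFinP.
by apply: measurable_funX; exact: (measurable_L2_0pi LB).
Qed.

Let upos := fucik_solution_pos a0 b0 d0 sol rd.
Let uneg := fucik_solution_neg a0 b0 d0 sol rd.

(** Here P + Q = 2 m (l1 + l2) - 2 pi = 0: there is no drift, and the mean squared phase error is
    P^2 / 3 on every bump. *)
Lemma even_distance m : m%:R * (l1 + l2) = pi -> n = m.*2 ->
  nrm (u \- sines n) ^+ 2 <=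
  m%:R * (l1 * (1 - A) ^+ 2 + l2 * (1 - B) ^+ 2) + pi * (P ^+ 2 / 3).
Proof.
move=> ml nm; rewrite -lee_fin nrm_dist.
have := integral_bumps n (ltW l1_gt0) (ltW l2_gt0) al1 bl2 A01 B01 mu_u upos uneg (k := m).
rewrite ml lexx => /(_ isT)/le_trans; apply.
have QE : Q = - P.
  have nE : n%:R = 2 * m%:R :> R by rewrite nm -muln2 natrM mulrC.
  by rewrite /P /Q nE; move: ml; lra.
rewrite lee_fin sum_bump_bounds -/P -/Q QE subrr -ml le_eqVlt; apply/orP; left.
by apply/eqP; field.
Qed.

(** There are m full pairs and one more positive bump. The phase error vanishes at pi, which forces
    P = - m T and Q = (m + 1) T with T = l2 - l1. *)
Lemma odd_distance m : (m%:R + 1) * l1 + m%:R * l2 = pi -> n = m.*2.+1 ->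
  nrm (u \- sines n) ^+ 2 <=
  (m%:R + 1) * (l1 * (1 - A) ^+ 2) + m%:R * (l2 * (1 - B) ^+ 2)
  + pi * (n%:R * (l1 + l2) - 2 * pi) ^+ 2 * (m%:R * (m%:R + 1) / 6).
Proof.
move=> ml nm; rewrite -lee_fin nrm_dist.
have mlE : m%:R * (l1 + l2) + l1 = pi by rewrite -ml; ring.
have mpi : m%:R * (l1 + l2) <= pi by rewrite -mlE lerDl ltW.
have := integral_pos_bump n (ltW l1_gt0) (ltW l2_gt0) al1 A01 mu_u upos (k := m).
rewrite mlE lexx => /(_ isT)/le_trans; apply.
have := integral_bumps n (ltW l1_gt0) (ltW l2_gt0) al1 bl2 A01 B01 mu_u upos uneg mpi.
move=> /(leeD2r (pos_bound n l1 l2 A m)%:E)/le_trans; apply.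
rewrite -EFinD lee_fin sum_bump_bounds /pos_bound -/P -/Q.
have nE : n%:R = 2 * m%:R + 1 :> R by rewrite nm -natr1 -muln2 natrM mulrC.
pose T := n%:R * (l1 + l2) - 2 * pi.
have PE : P = - (m%:R * T) by rewrite /P /T nE -ml; ring.
have QE : Q = (m%:R + 1) * T by rewrite /Q /T nE -ml; ring.
rewrite -/T PE QE -ml le_eqVlt; apply/orP; left.
by apply/eqP; field.
Qed.

End eigenfunction.

Lemma fucik_distance (n : nat) (a b : R) (u : R -> R) : (2 <= n)%N ->
  Gamma n (a, b) -> normalized_fucik_eigenfunction n a b u ->
  L2_0pi u /\ nrm (u \- sines n) ^+ 2 <= fucik_C n a b.
Proof.
move=> n2 [/= a0 b0 G]; rewrite /normalized_fucik_eigenfunction gtn_eqF// => -[sol [d d0 rd] supu].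
split; first by apply: L2_0pi_within_continuous; case: sol => -[].
have sa : 0 < Num.sqrt a by rewrite sqrtr_gt0.
have sb : 0 < Num.sqrt b by rewrite sqrtr_gt0.
pose m := n./2; have m1 : (1 <= m)%N by rewrite half_gt0.
have m1R : 1 <= m%:R :> R by rewrite ler1n.
have m0R : 0 < m%:R :> R by rewrite ltr0n.
have n0R : 0 < n%:R :> R by rewrite ltr0n (ltn_trans _ n2).
have nE := odd_double_half n; rewrite -/m in nE.
move: G; set l1 := pi / Num.sqrt a; set l2 := pi / Num.sqrt b => G.
have l1_gt0 : 0 < l1 by rewrite divr_gt0 ?pi_gt0.
have l2_gt0 : 0 < l2 by rewrite divr_gt0 ?pi_gt0.
have al1 : Num.sqrt a * l1 = pi by rewrite mulrC divfK// gt_eqF.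
have bl2 : Num.sqrt b * l2 = pi by rewrite mulrC divfK// gt_eqF.
(* Produces the [e] of the numerical bounds. It is nonnegative for the larger frequency, whose bump
   is no longer than the mean length pi / n. *)
have excess (c l : R) : 0 < l -> c * l = pi -> n%:R * l <= pi ->
    0 <= c / n%:R - 1 /\ n%:R * l * (1 + (c / n%:R - 1)) = pi.
  move=> l0 cl nl; split; last by rewrite -cl; field; rewrite gt_eqF.
  by rewrite subr_ge0 ler_pdivlMr// mul1r -(ler_pM2r l0) cl.
have l12 : Num.sqrt b <= Num.sqrt a -> l1 <= l2.
  by move=> ba; rewrite ler_wpM2l ?pi_ge0// lef_pV2.
have l21 : Num.sqrt a <= Num.sqrt b -> l2 <= l1.
  by move=> ba; rewrite ler_wpM2l ?pi_ge0// lef_pV2.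
have [on|en] := boolP (odd n).
  rewrite on add1n in nE; rewrite on in G.
  have nR : n%:R = 2 * m%:R + 1 :> R by rewrite -nE -natr1 -muln2 natrM mulrC.
  have {}G : (m%:R + 1) * l1 + m%:R * l2 = pi by rewrite -[RHS]G nR; field.
  have lpi : l1 + l2 <= pi.
    by rewrite -G; have := ler_wpM2r (ltW l1_gt0) m1R; have := ler_wpM2r (ltW l2_gt0) m1R; lra.
  have D := odd_distance a0 b0 d0 sol rd supu lpi G (esym nE).
  rewrite /fucik_C on/=; case: ifPn => [ba|].
    have sba : Num.sqrt b <= Num.sqrt a by exact: (@ler_wsqrtr R _ _ ba).
    have [AE BE] := amplitude_ge a0 b0 d0 sol rd supu lpi sba.
    have [|e0 ne] := excess _ _ l1_gt0 al1.
      by rewrite -G nR; have := ler_wpM2l (ltW m0R) (l12 sba); lra.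
    apply: (le_trans D); rewrite AE BE subrr expr0n/= !mulr0 addr0.
    exact: odd_bound_ge.
  rewrite -ltNge => /ltW ab.
  have sab : Num.sqrt a <= Num.sqrt b by exact: (@ler_wsqrtr R _ _ ab).
  have [AE BE] := amplitude_lt a0 b0 d0 sol rd supu lpi sab.
  have [|e0 ne] := excess _ _ l2_gt0 bl2.
    by rewrite -G nR; have := ler_wpM2l (addr_ge0 (ltW m0R) ler01) (l21 sab); lra.
  apply: (le_trans D); rewrite AE BE subrr expr0n/= !mulr0 add0r.
  exact: odd_bound_lt.
rewrite (negbTE en) add0n in nE; rewrite (negbTE en) in G.
have nR : n%:R = 2 * m%:R :> R by rewrite -nE -muln2 natrM mulrC.
have {}G : m%:R * (l1 + l2) = pi by rewrite -[RHS]G nR; field.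
have lpi : l1 + l2 <= pi.
  by rewrite -G; have := ler_wpM2r (ltW (addr_gt0 l1_gt0 l2_gt0)) m1R; lra.
have D := even_distance a0 b0 d0 sol rd supu lpi G (esym nE).
rewrite /fucik_C en; have [sba|sab] := leP (Num.sqrt b) (Num.sqrt a).
  have [AE BE] := amplitude_ge a0 b0 d0 sol rd supu lpi sba.
  have [|e0 ne] := excess _ _ l1_gt0 al1.
    by rewrite -G nR; have := ler_wpM2l (ltW m0R) (l12 sba); lra.
  apply: (le_trans D); rewrite AE BE subrr expr0n/= !mulr0 addr0 nR.
  by apply: even_bound => //; rewrite -nR.
have [AE BE] := amplitude_lt a0 b0 d0 sol rd supu lpi (ltW sab).
have [|e0 ne] := excess _ _ l2_gt0 bl2.
  by rewrite -G nR; have := ler_wpM2l (ltW m0R) (l21 (ltW sab)); lra.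
apply: (le_trans D); rewrite AE BE subrr expr0n/= !mulr0 add0r nR.
(* Without drift P = - Q, so the phase term is symmetric and [even_bound] applies with l1 and l2
   exchanged. *)
have -> : (2 * m%:R * (pi / Num.sqrt a) - pi) ^+ 2 = (2 * m%:R * l2 - pi) ^+ 2.
  rewrite -[RHS]sqrrN -/l1; congr (_ ^+ 2); move: G; lra.
by apply: even_bound; rewrite -?nR// [l2 + _]addrC.
Qed.

End distance.

Theorem theorem1p4 (R : realType) (alpha beta : nat -> R) (F : nat -> R -> R)
  (hF : fucik_system alpha beta F)
  (hsum : (\sum_(2 <= n <oo) (fucik_C n (alpha n) (beta n))%:E
            < (pi / 2)%:E)%E) :
  riesz_basis F.
Proof.
case: hF => _ _ hGamma hF.
have C_ge0 n x y : 0 <= fucik_C n x y :> R.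
  have p0 := pi_ge0 R.
  have q0 (r t : R) : 0 <= r ^+ 2 * (r ^+ 2 + 1) / t ^+ 4.
    by rewrite divr_ge0 ?exprn_even_ge0// mulr_ge0 ?addr_ge0 ?sqr_ge0.
  rewrite /fucik_C; case: ifP => _; last first.
    by case: ifP => _; rewrite mulr_ge0 ?sqr_ge0// mulr_ge0// mulr_ge0.
  by rewrite mulr_ge0 ?sqr_ge0// divr_ge0// mulr_ge0// mulr_ge0// addr_ge0// sqr_ge0.
(* The first function is sin x itself, at distance 0, which is why the series can start at 2. *)
pose C n := if n == 1%N then 0 else fucik_C n (alpha n) (beta n).
pose S := (\sum_(2 <= n <oo) (fucik_C n (alpha n) (beta n))%:E)%E.
have S_ge0 : (0 <= S)%E by apply: nneseries_ge0 => n _ _; rewrite lee_fin.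
have S_fin : S \is a fin_num by rewrite ge0_fin_numE// (lt_trans hsum)// ltry.
have F1 (x : R) : `]0, pi[%classic x -> F 1%N x = sines 1 x.
  have := hF 1%N isT; rewrite /normalized_fucik_eigenfunction eqxx => h.
  by rewrite /= in_itv/= => /andP[/ltW x0 /ltW xpi]; rewrite h ?in_itv/= ?x0// /sines mul1r.
have key n : (1 <= n)%N -> L2_0pi (F n) /\ nrm (F n \- sines n) ^+ 2 <= C n.
  case: n => [//|[|n]] _; last first.
    by rewrite /C/=; apply: fucik_distance => //; [exact: hGamma|exact: hF].
  split; first by rewrite (eq_L2_0pi F1); exact: L2_0pi_sines.
  have -> : nrm (F 1%N \- sines 1) = nrm (fun=> 0 : R).
    by apply: eq_nrm => x xI /=; rewrite F1// subrr.
  by rewrite nrm0 expr0n /C eqxx.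
apply: (@paley_wiener _ (@sines R) F C (pi / 2) (fine S)).
- by move=> n _; exact: L2_0pi_sines.
- by move=> n /key[].
- exact: complete_sines.
- exact: nrm_lincomb_sines.
- by move=> n /key[].
- case=> [|N]; first by rewrite big_geq// fine_ge0.
  rewrite big_ltn// {1}/C eqxx add0r -lee_fin fineK// -sumEFin.
  rewrite (_ : (\sum_(2 <= i < N.+2) (C i)%:E)%E =
    (\sum_(2 <= i < N.+2) (fucik_C i (alpha i) (beta i))%:E)%E); last first.
    by apply: eq_big_nat => i /andP[i2 _]; rewrite /C gtn_eqF.
  by apply: nneseries_lim_ge => i _ _; rewrite lee_fin.
- by rewrite -lte_fin fineK.
Qed.
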